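(* Let $f(z)=z+\sum_{n\ge 2}a_nz^n\in\mathcal{BT}_{\mathfrak{B}}$ and let $\Gamma_1,\Gamma_2$ be its logarithmic inverse coefficients. Then $$-\frac{1}{2\sqrt{29}}\le|\Gamma_2|-|\Gamma_1|\le\frac1{12}.$$ Both inequalities are sharp: the upper bound is attained by $f_2(z)=\int_0^z\sqrt{1+\tanh(t^2)}\,dt$, and the lower bound by the function $f$ with $f(0)=0$, $f'(z)=\sqrt{1+\tanh(\omega(z))}$, where $\omega=\frac{p-1}{p+1}$ and $p(z)=\dfrac{1+\frac{8}{\sqrt{29}}z+z^2}{1-z^2}$.
   Context: $\mathbb{D}=\{z\in\mathbb{C}:|z|<1\}$. $\mathcal{S}$ is the class of univalent analytic functions $f$ on $\mathbb{D}$ normalized by $f(0)=0$, $f'(0)=1$, i.e. $f(z)=z+\sum_{n\ge2}a_nz^n$. For analytic $g,h$ on $\mathbb{D}$, $g\prec h$ means there is an analytic $\omega:\mathbb{D}\to\mathbb{D}$ with $\omega(0)=0$ and $g=h\circ\omega$. Let $\mathfrak{B}(z)=\sqrt{1+\tanh z}$ (principal branch, $\mathfrak{B}(0)=1$). The class $\mathcal{BT}_{\mathfrak{B}}$ is $\{f\in\mathcal{S}: f'(z)\prec \mathfrak{B}(z)\}$. The logarithmic inverse coefficients $\Gamma_n$ are defined by $\log\frac{f^{-1}(w)}{w}=2\sum_{n\ge1}\Gamma_n w^n$ near $w=0$; explicitly $\Gamma_1=-\tfrac12a_2$, $\Gamma_2=-\tfrac12(a_3-\tfrac32a_2^2)$.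 *)

(* Defs.v *)
From HB Require Import structures.
From mathcomp Require Import all_boot all_order all_algebra.
From mathcomp Require Import all_classical all_reals.
From mathcomp Require Import topology normedtype sequences derive exp trigo.
From mathcomp.real_closed Require Import complex.
Set Implicit Arguments. Unset Strict Implicit. Unset Printing Implicit Defensive.
Import Order.TTheory GRing.Theory Num.Theory.
Import numFieldTopology.Exports numFieldNormedType.Exports.
Local Open Scope ring_scope.
Local Open Scope complex_scope.

(* topology / normed-module structure of C = R[i] over itself, as given by
   MathComp-Analysis for any numClosedFieldType *)
HB.instance Definition _ (R : realType) := PseudoPointedMetric.copy R[i] (R[i])^o.
HB.instance Definition _ (R : realType) := NormedModule.copy R[i] (R[i])^o.

Section Defs.
Variable R : realType.
Local Notation C := R[i].

Definition inD (z : C) : Prop := `|z| < 1.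

Definition pser (a : nat -> C) (z : C) : C :=
  limn (series (fun k => a k * z ^+ k)).

(* the power series with coefficients a converges at every point of D,
   i.e. it defines an analytic function on D *)
Definition analytic_on_D (a : nat -> C) : Prop :=
  forall z, inD z -> cvgn (series (fun k => a k * z ^+ k)).

Definition cexp (z : C) : C :=
  let: x +i* y := z in (expR x * cos y) +i* (expR x * sin y).
Definition ctanh (z : C) : C := (cexp z - cexp (- z)) / (cexp z + cexp (- z)).

(* B(z) = sqrt(1 + tanh z), principal branch (sqrtc is the principal
   square root: Re >= 0, and Im >= 0 on the cut) *)
Definition Bfun (z : C) : C := sqrtc (1 + ctanh z).

Definition in_S (a : nat -> C) : Prop :=
  [/\ a 0%N = 0, a 1%N = 1, analytic_on_D a &
      forall z w, inD z -> inD w -> pser a z = pser a w -> z = w].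

Definition subord_B (g : C -> C) : Prop :=
  exists c : nat -> C,
    [/\ c 0%N = 0, analytic_on_D c, (forall z, inD z -> inD (pser c z)) &
        forall z, inD z -> g z = Bfun (pser c z)].

Definition in_BT (a : nat -> C) : Prop :=
  in_S a /\ subord_B (fun z => derive1 (pser a) z).

Definition Gamma1 (a : nat -> C) : C := - (a 2%N) / 2.
Definition Gamma2 (a : nat -> C) : C := - (a 3%N - 3 / 2 * a 2%N ^+ 2) / 2.

Definition p_low (z : C) : C :=
  (1 + (8 / Num.sqrt (29 : R))%:C * z + z ^+ 2) / (1 - z ^+ 2).
Definition omega_low (z : C) : C := (p_low z - 1) / (p_low z + 1).

End Defs.

(* Main.v *)
(** Write f' = B(w) where w is a Schwarz function with Taylor coefficients c_k. Since
    B(u)^2 (1 + exp(-2u)) = 2, comparing coefficients gives Gamma_1 = -c_1/8 and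
    Gamma_2 = 13 c_1^2/192 - c_2/12, and the two bounds follow from
    |c_2| <= 1 - |c_1|^2, which says that the 2x2 Toeplitz matrix of w/z is a
    contraction; this is Bessel's inequality on circles |z| = r, with integrals
    replaced by averages over roots of unity.

    For sharpness take w(z) = z^2 and w(z) = z (z + x)/(1 + x z) with
    x = 4/sqrt 29. That B(w) has a power series converging on the whole disk is
    a Weierstrass argument: B(u) = exp(u/2) / sqrt(cosh u), |cosh u - 1| <= 7/10
    for |u| <= 1, and Newton's iteration for the inverse square root converges
    uniformly there. Moreover Re B > 0, so that its primitive is univalent
    (Noshiro-Warschawski). *)

Require Import Defs.
From HB Require Import structures.
From mathcomp Require Import all_boot all_order all_algebra.
From mathcomp Require Import all_classical all_reals.
From mathcomp Require Import topology normedtype sequences derive exp trigo.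
From mathcomp.real_closed Require Import complex.
From mathcomp Require Import cyclic separable cyclotomic ring lra.
Import Order.TTheory GRing.Theory Num.Theory.
Import numFieldTopology.Exports numFieldNormedType.Exports.
Local Open Scope ring_scope.
Local Open Scope complex_scope.
Set Implicit Arguments. Unset Strict Implicit. Unset Printing Implicit Defensive.

(** * The modulus and convergence in R[i] *)

Section S1.
Local Open Scope classical_set_scope.
Local Open Scope ring_scope.
Local Open Scope complex_scope.
Variable R : realType.
Local Notation C := R[i].
Local Notation Re := (@complex.Re R).
Local Notation Im := (@complex.Im R).
Implicit Types z w : C.

(** Membership in the class asks for coefficients whose series converges on the whole disk, while
    [Bfun] is a root of a quotient of exponentials built from real functions. Neither contour
    integrals nor composition of power series is used: analyticity is carried by [papprox], uniform
    polynomial approximation on smaller disks, which survives sums, products, exponentials and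
    limits, and which is turned into coefficients only at the end.

    This explains the choice of the root of cosh. Newton's iteration, started at 1, is controlled on
    a disk about 1 of radius less than 1. The values of 1 + tanh u leave that disk, since |tanh i| =
    tan 1 > 1, but those of cosh u do not, and the remaining factor exp(u/2) is entire.

    The coefficients of B(w) are likewise not obtained by expanding a square root: its series is
    given, and second-order expansions with a bounded cubic remainder are compared in the equation
    that B satisfies. For a polynomial, averages over n-th roots of unity are exact as soon as n
    exceeds the degree, so the coefficient estimates involve only finite sums. *)

Definition cmod (z : C) : R := Re `|z|.

(** The norm of [R[i]] takes its values in [R[i]]; through [cmod] estimates move to the ordered
    field [R], where [lra] and [nra] apply. *)
Lemma normE z : `|z| = (cmod z)%:C.
Proof. by rewrite /cmod normc_def. Qed.

Lemma cmodE z : cmod z = Num.sqrt (Re z ^+ 2 + Im z ^+ 2).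
Proof. by rewrite /cmod normc_def. Qed.

Lemma complexr_inj : injective (fun r : R => r%:C).
Proof. by move=> x y []. Qed.

Lemma cmod_ge0 z : 0 <= cmod z.
Proof. by rewrite cmodE sqrtr_ge0. Qed.

Lemma sqr_cmod z : cmod z ^+ 2 = Re z ^+ 2 + Im z ^+ 2.
Proof. by rewrite cmodE sqr_sqrtr // addr_ge0 // sqr_ge0. Qed.

Lemma cmodM z w : cmod (z * w) = cmod z * cmod w.
Proof. by apply: complexr_inj; rewrite rmorphM -!normE normrM. Qed.

Lemma cmodD z w : cmod (z + w) <= cmod z + cmod w.
Proof. by rewrite -lecR rmorphD -!normE ler_normD. Qed.

Lemma cmodN z : cmod (- z) = cmod z.
Proof. by apply: complexr_inj; rewrite -!normE normrN. Qed.

Lemma cmodB z w : cmod (z - w) <= cmod z + cmod w.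
Proof. by rewrite -(cmodN w) cmodD. Qed.

Lemma cmodBC z w : cmod (z - w) = cmod (w - z).
Proof. by rewrite -cmodN opprB. Qed.

Lemma cmod_eq0 z : cmod z = 0 -> z = 0.
Proof. by move=> h; apply/eqP; rewrite -normr_eq0 normE h. Qed.

Lemma cmod_gt0 z : z != 0 -> 0 < cmod z.
Proof.
move=> z0; rewrite lt_neqAle cmod_ge0 andbT eq_sym.
by apply: contra z0 => /eqP /cmod_eq0 ->.
Qed.

Lemma cmodr (r : R) : cmod r%:C = `|r|.
Proof. by rewrite cmodE /= expr0n /= addr0 sqrtr_sqr. Qed.

Lemma cmod0 : cmod 0 = 0.
Proof. by rewrite -[0]/(0%:C) cmodr normr0. Qed.

Lemma cmod1 : cmod 1 = 1.
Proof. by rewrite -[1]/(1%:C) cmodr normr1. Qed.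

Lemma cmodX z n : cmod (z ^+ n) = cmod z ^+ n.
Proof. by elim: n => [|n IH]; rewrite ?expr0 ?cmod1 // !exprS cmodM IH. Qed.

Lemma cmodV z : cmod z^-1 = (cmod z)^-1.
Proof.
have [->|z0] := eqVneq z 0; first by rewrite invr0 cmod0 invr0.
have /mulfI : cmod z != 0 by rewrite gt_eqF // cmod_gt0.
by apply; rewrite -cmodM !mulfV ?cmod1 // gt_eqF // cmod_gt0.
Qed.

Lemma cmod_nat n : cmod n%:R = n%:R.
Proof. by rewrite -(rmorph_nat (@real_complex R)) cmodr ger0_norm. Qed.

Lemma cmod_conj z : cmod z^* = cmod z.
Proof. by rewrite !cmodE; case: z => a b /=; rewrite sqrrN. Qed.

Lemma mulrJ z : z * z^* = (cmod z ^+ 2)%:C.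
Proof. by rewrite -sqr_normc normE rmorphXn. Qed.

Lemma Re_le_nm z : `|Re z| <= cmod z.
Proof.
by rewrite -(ler_pXn2r (n := 2)) ?nnegrE ?cmod_ge0 // real_normK ?num_real //
  sqr_cmod lerDl sqr_ge0.
Qed.

Lemma Im_le_nm z : `|Im z| <= cmod z.
Proof.
by rewrite -(ler_pXn2r (n := 2)) ?nnegrE ?cmod_ge0 // real_normK ?num_real //
  sqr_cmod lerDr sqr_ge0.
Qed.

Lemma cmod_le_ReIm z : cmod z <= `|Re z| + `|Im z|.
Proof.
rewrite -(ler_pXn2r (n := 2)) ?nnegrE ?cmod_ge0 ?addr_ge0 // sqr_cmod.
rewrite -(real_normK (num_real (Re z))) -(real_normK (num_real (Im z))).
have := normr_ge0 (Re z); have := normr_ge0 (Im z); nra.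
Qed.

Lemma inDE z : inD z <-> cmod z < 1.
Proof. by rewrite /inD normE -[1]/(1%:C) ltcR. Qed.

Lemma cmod_sum (I : Type) (s : seq I) (P : pred I) (F : I -> C) :
  cmod (\sum_(i <- s | P i) F i) <= \sum_(i <- s | P i) cmod (F i).
Proof.
elim/big_rec2: _ => [|i y x _ h]; first by rewrite cmod0.
by rewrite (le_trans (cmodD _ _)) // lerD2l.
Qed.

Lemma cmod_triB z w u : cmod (z - u) <= cmod (z - w) + cmod (w - u).
Proof. by rewrite -(subrKA w) cmodD. Qed.

Lemma cvgnCP (u : nat -> C) (l : C) : u @ \oo --> l <->
  forall e : R, 0 < e -> exists N, forall n, (N <= n)%N -> cmod (u n - l) <= e.
Proof.
split=> [/cvgrPdist_le h e e0|h].
  have e0' : 0 < (e%:C : C) by rewrite -[0]/(0%:C) ltcR.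
  have [N _ hN] := h _ e0'; exists N => n Nn.
  by have := hN n Nn; rewrite normE lecR cmodBC.
apply/cvgrPdist_le => e e0.
(* In the partial order of [R[i]] a positive element is real, so complex and real tolerances are
   interchangeable. *)
have eE : e = (Re e)%:C by rewrite RRe_real // ger0_real // ltW.
have [N hN] : exists N, forall n, (N <= n)%N -> cmod (u n - l) <= Re e.
  by apply: h; rewrite -ltcR -eE.
by exists N => // n /= Nn; rewrite eE normE lecR cmodBC hN.
Qed.

Lemma limnC (u : nat -> C) (l : C) : u @ \oo --> l -> limn u = l.
Proof. by move=> h; apply/cvg_lim => //; exact: norm_hausdorff. Qed.

Lemma cauchyC (u : nat -> C) :
  (forall e : R, 0 < e -> exists N, forall n, (N <= n)%N -> cmod (u n - u N) <= e) ->
  cvgn u.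
Proof.
move=> h.
have aux (f : C -> R) : (forall z w, f (z - w) = f z - f w) -> (forall z, `|f z| <= cmod z) ->
    cvgn (f \o u).
  move=> fB fn; apply: cauchy_cvg; apply: cauchy_exP => e e0.
  have [N hN] := h (e / 2) ltac:(lra).
  exists (f (u N)); exists N => // n /= Nn; rewrite -ball_normE /ball_ /= distrC -fB.
  by rewrite (le_lt_trans (fn _)) // (le_lt_trans (hN n Nn)) //; lra.
have /cvg_ex [/= x /cvgrPdist_le hx] := aux Re (fun z w => raddfB Re z w) Re_le_nm.
have /cvg_ex [/= y /cvgrPdist_le hy] := aux Im (fun z w => raddfB Im z w) Im_le_nm.
apply/cvg_ex; exists (x +i* y); apply/cvgnCP => e e0.
have [M _ hM] := hx (e / 2) ltac:(lra).
have [N _ hN] := hy (e / 2) ltac:(lra).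
exists (maxn M N) => n; rewrite geq_max => /andP[Mn Nn].
rewrite cmodBC (le_trans (cmod_le_ReIm _)) //.
have := hM n Mn; have := hN n Nn; rewrite /=.
by case: (u n) => a b /=; lra.
Qed.
End S1.

(** * Power series with radius of convergence at least 1 *)

Section S2.
Local Open Scope classical_set_scope.
Local Open Scope ring_scope.
Local Open Scope complex_scope.
Variable R : realType.
Local Notation C := R[i].
Local Notation Re := (@complex.Re R).
Local Notation Im := (@complex.Im R).
Implicit Types (z w : C) (a b c : nat -> C).

Definition psum (a : nat -> C) (n : nat) : {poly C} := \poly_(k < n) a k.

Lemma series_psum a n z : series (fun k => a k * z ^+ k) n = (psum a n).[z].
Proof. by rewrite seriesEnat /= big_mkord horner_poly. Qed.

Lemma series_psumE a z : series (fun k => a k * z ^+ k) = (fun n => (psum a n).[z]).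
Proof. by apply/funext => n; exact: series_psum. Qed.

(** Coefficient form of convergence on the disk, equivalent to [analytic_on_D] by the two lemmas
    below. Shifts, derivatives and primitives are easy to control in this form. *)
Definition rad_ge1 (a : nat -> C) : Prop :=
  forall r : R, 0 < r -> r < 1 -> exists K : R, forall k, cmod (a k) * r ^+ k <= K.

Lemma geo_sum_le (q : R) n m : 0 <= q -> q < 1 ->
  \sum_(n <= k < m) q ^+ k <= q ^+ n / (1 - q).
Proof.
move=> q0 q1; have d : 0 < 1 - q by lra.
have [mn|le_nm] := leqP m n.
  by rewrite big_geq // divr_ge0 ?exprn_ge0 // ltW.
suff -> : \sum_(n <= k < m) q ^+ k = (q ^+ n - q ^+ m) / (1 - q).
  by rewrite ler_pM2r ?invr_gt0 // gerBl exprn_ge0.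
apply: (mulIf (lt0r_neq0 d)); rewrite divfK ?lt0r_neq0 // big_distrl /=.
rewrite -[RHS]opprB -(telescope_sumr (fun k => q ^+ k) (ltnW le_nm)) -sumrN.
by apply: eq_bigr => k _; rewrite exprS; ring.
Qed.

Lemma expr_small (q e : R) : 0 <= q -> q < 1 -> 0 < e ->
  exists N, forall n, (N <= n)%N -> q ^+ n <= e.
Proof.
move=> q0 q1 e0; have : `|q| < 1 by rewrite ger0_norm.
move/cvg_expr/cvgrPdist_le => /(_ e e0) [N _ h]; exists N => n Nn.
by have := h n Nn; rewrite sub0r normrN ger0_norm // exprn_ge0.
Qed.

Lemma analytic_rad_ge1 a : analytic_on_D a -> rad_ge1 a.
Proof.
move=> h r r0 r1.
have /h /cvg_ex [l /cvgnCP /(_ 1 ltr01) [N hN]] : inD r%:C.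
  by rewrite inDE cmodr gtr0_norm.
(* From index [N] on, consecutive partial sums are each within 1 of the limit, hence the 2; the sum
   covers the earlier terms. *)
exists (2 + \sum_(k < N) cmod (a k) * r ^+ k) => k.
have ge0 j : 0 <= cmod (a j) * r ^+ j by rewrite mulr_ge0 ?cmod_ge0 // exprn_ge0 // ltW.
have [kN|Nk] := ltnP k N.
  rewrite (bigD1 (Ordinal kN)) //= addrCA lerDl addr_ge0 //.
  by apply: sumr_ge0.
rewrite (@le_trans _ _ 2) // ?lerDl ?sumr_ge0 //.
have -> : cmod (a k) * r ^+ k = cmod (a k * (r%:C) ^+ k).
  by rewrite cmodM cmodX cmodr (gtr0_norm r0).
have -> : a k * r%:C ^+ k = series (fun k => a k * r%:C ^+
  k) k.+1 - series (fun k => a k * r%:C ^+ k) k.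
  by rewrite !seriesEnat /= big_nat_recr //= [_ + a k * _]addrC addrK.
rewrite (le_trans (cmod_triB _ l _)) // [X in _ + X]cmodBC.
by have := hN k Nk; have := hN k.+1 (leqW Nk); lra.
Qed.

(** Comparison with a geometric series: the coefficients are controlled at a radius [s] midway
    between [r] and 1, so the terms decay like (r/s)^k. One pair [K], [q] serves the whole closed
    disk, which makes the convergence uniform. *)
Lemma psum_tail_le a (r : R) : rad_ge1 a -> 0 <= r -> r < 1 ->
  exists K q : R, [/\ 0 <= K, 0 <= q, q < 1 & forall z, cmod z <= r ->
    forall n m, (n <= m)%N -> cmod ((psum a m).[z] - (psum a n).[z]) <= K * q ^+ n].
Proof.
move=> ga r0 r1; pose s := (r + 1) / 2.
have s0 : 0 < s by rewrite /s; lra.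
have s1 : s < 1 by rewrite /s; lra.
have [K hK] := ga s s0 s1.
have K0 : 0 <= K by apply: le_trans (hK 0%N); rewrite mulr1 cmod_ge0.
pose q := r / s.
have q0 : 0 <= q by rewrite divr_ge0 // ltW.
have q1 : q < 1 by rewrite ltr_pdivrMr // mul1r /s; lra.
have d : 0 < 1 - q by lra.
exists (K / (1 - q)), q; split => //; first by rewrite divr_ge0 // ltW.
move=> z zr n m le_nm; rewrite !horner_poly -!(big_mkord xpredT (fun k => a k * z ^+ k)).
rewrite (big_cat_nat (leq0n n) le_nm) //= [_ - _]addrAC subrr add0r.
rewrite (le_trans (cmod_sum _ _ _)) // (@le_trans _ _ (\sum_(n <= k < m) K * q ^+ k)) //.
  apply: ler_sum => k _; rewrite cmodM cmodX.
  rewrite (@le_trans _ _ (cmod (a k) * r ^+ k)) //.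
    by rewrite ler_wpM2l ?cmod_ge0 // lerXn2r ?nnegrE ?cmod_ge0.
  have -> : r ^+ k = s ^+ k * q ^+ k by rewrite -exprMn /q mulrC divfK // gt_eqF.
  by rewrite mulrA ler_wpM2r ?exprn_ge0.
by rewrite -big_distrr /= -mulrA ler_wpM2l // mulrC geo_sum_le.
Qed.

Lemma geo_small (K q e : R) : 0 <= K -> 0 <= q -> q < 1 -> 0 < e ->
  exists N, forall n, (N <= n)%N -> K * q ^+ n <= e.
Proof.
move=> K0 q0 q1 e0; have [N hN] := expr_small q0 q1 (divr_gt0 e0 (ltr_wpDl K0 ltr01)).
exists N => n /hN; rewrite ler_pdivlMr ?ltr_wpDl // => h.
by have := exprn_ge0 n q0; nra.
Qed.

Lemma rad_ge1_analytic a : rad_ge1 a -> analytic_on_D a.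
Proof.
move=> ga z /inDE z1; apply: cauchyC => e e0.
have [K [q [K0 q0 q1 h]]] := psum_tail_le ga (cmod_ge0 z) z1.
have [N hN] := geo_small K0 q0 q1 e0.
by exists N => n Nn; rewrite !series_psum (le_trans (h _ _ _ _ Nn)) // hN.
Qed.

Lemma pser_cvg a z : rad_ge1 a -> cmod z < 1 -> forall e : R, 0 < e ->
  exists N, forall n, (N <= n)%N -> cmod ((psum a n).[z] - pser a z) <= e.
Proof.
move=> /rad_ge1_analytic h /inDE /h hz; apply/cvgnCP.
by move: hz; rewrite /pser series_psumE.
Qed.

Lemma pser_uniq a z l :
  (forall e : R, 0 < e -> exists N, forall n, (N <= n)%N -> cmod ((psum a n).[z] - l) <= e) ->
  pser a z = l.
Proof.
by move=> /cvgnCP h; rewrite /pser series_psumE; exact: limnC.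
Qed.

Lemma pser_psum_dist a (r : R) : rad_ge1 a -> 0 <= r -> r < 1 ->
  exists K q : R, [/\ 0 <= K, 0 <= q, q < 1 & forall z, cmod z <= r ->
    forall n, cmod (pser a z - (psum a n).[z]) <= K * q ^+ n].
Proof.
move=> ga r0 r1; have [K [q [K0 q0 q1 h]]] := psum_tail_le ga r0 r1.
exists K, q; split=> // z zr n; apply/ler_addgt0Pr => e e0.
have [N hN] := pser_cvg ga (le_lt_trans zr r1) e0.
rewrite (le_trans (cmod_triB _ (psum a (maxn N n)).[z] _)) // addrC lerD //.
  by rewrite h // leq_maxr.
by rewrite cmodBC hN // leq_maxl.
Qed.

Lemma rad_ge1_mulrn a : rad_ge1 a -> rad_ge1 (fun k => a k *+ k).
Proof.
move=> ga r r0 r1; pose s := (r + 1) / 2.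
have s0 : 0 < s by rewrite /s; lra.
have s1 : s < 1 by rewrite /s; lra.
have [K hK] := ga s s0 s1.
(* With s = (1 + t) r, Bernoulli's inequality k t <= (1 + t)^k absorbs the factor k into the passage
   from radius [r] to [s]. *)
pose t := s / r - 1.
have t0 : 0 < t by rewrite /t subr_gt0 ltr_pdivlMr // mul1r /s; lra.
have bern k : k%:R * t <= (1 + t) ^+ k.
  elim: k => [|k IH]; first by rewrite mul0r ler01.
  rewrite exprS -natr1; have : 1 <= (1 + t) ^+ k by rewrite exprn_ege1 // lerDl ltW.
  nra.
exists (K / t) => k; rewrite -mulr_natr cmodM cmod_nat ler_pdivlMr //.
rewrite (le_trans _ (hK k)) // -!mulrA ler_wpM2l ?cmod_ge0 //.
have -> : s = (1 + t) * r by rewrite /t addrC subrK divfK // gt_eqF.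
by rewrite exprMn mulrCA mulrC ler_wpM2r ?exprn_ge0 ?bern // ltW.
Qed.

Lemma rad_ge1_shift a : rad_ge1 a -> rad_ge1 (fun k => a k.+1).
Proof.
move=> ga r r0 r1; have [K hK] := ga r r0 r1.
exists (K / r) => k; rewrite ler_pdivlMr // -mulrA -exprSr; exact: hK.
Qed.

Definition dcoef a k := a k.+1 *+ k.+1.

Lemma rad_ge1_dcoef a : rad_ge1 a -> rad_ge1 (dcoef a).
Proof. by move=> /rad_ge1_mulrn /rad_ge1_shift. Qed.

Definition icoef b k : C := if k is j.+1 then b j / j.+1%:R else 0.

Lemma rad_ge1_icoef b : rad_ge1 b -> rad_ge1 (icoef b).
Proof.
move=> gb r r0 r1; have [K hK] := gb r r0 r1.
have K0 : 0 <= K by apply: le_trans (hK 0%N); rewrite mulr1 cmod_ge0.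
exists K => -[|k] /=; first by rewrite cmod0 mul0r.
rewrite cmodM cmodV cmod_nat exprS (le_trans _ (hK k)) //.
have d : (k.+1%:R : R)^-1 <= 1 by rewrite invf_le1 ?ltr0n // ler1n.
have := cmod_ge0 (b k); have := exprn_ge0 k (ltW r0).
have i0 : 0 <= (k.+1%:R : R)^-1 by rewrite invr_ge0.
by move=> A B; rewrite -mulrA ler_wpM2l // mulrA ler_piMl // mulr_ile1 // ltW.
Qed.

Lemma dcoefK b : dcoef (icoef b) = b.
Proof.
apply/funext => k; rewrite /dcoef /icoef -[LHS]mulr_natr divfK //.
by rewrite pnatr_eq0.
Qed.
End S2.

(** * Coefficient inequalities from averages over roots of unity *)

Section S3.
Local Open Scope classical_set_scope.
Local Open Scope ring_scope.
Local Open Scope complex_scope.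
Variable R : realType.
Local Notation C := R[i].
Local Notation Re := (@complex.Re R).
Local Notation Im := (@complex.Im R).
Implicit Types (z w : C) (a b c : nat -> C).

Lemma eq_ler (x y : R) : x = y -> x <= y.
Proof. by move->. Qed.

(** In characteristic 0 the polynomial X^n - 1 is separable, so it has n distinct roots, and such a
    set contains a generator. *)
Lemma prim_root_exists (F : numClosedFieldType) n : (0 < n)%N ->
  exists x : F, n.-primitive_root x.
Proof.
move=> n0; have [rs /= E] := closed_field_poly_normal ('X^n - 1 : {poly F}).
have mon : 'X^n - 1 \is @monic F by rewrite monicXnsubC.
rewrite (monicP mon) scale1r in E.
have uq : uniq rs.
  by rewrite -separable_prod_XsubC -E separable_Xn_sub_1 // pnatr_eq0 -lt0n.
have : has n.-primitive_root rs.
  apply: has_prim_root => //; first by apply/allP=> x; rewrite -root_prod_XsubC -E unity_rootE;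
    rewrite /root !hornerE subr_eq0.
  by rewrite -ltnS -(size_prod_XsubC rs id) -E size_XnsubC.
by case/hasP => x _ ?; exists x.
Qed.

Lemma cmod_prim_root n (x : C) : n.-primitive_root x -> cmod x = 1.
Proof.
move=> h; apply/eqP; rewrite -(@pexpr_eq1 _ _ n) ?cmod_ge0 ?(prim_order_gt0 h) //.
by rewrite -cmodX (prim_expr_order h) cmod1.
Qed.

Lemma sum_prim_root_exp n (x : C) k : n.-primitive_root x ->
  \sum_(j < n) (x ^+ j) ^+ k = if (n %| k)%N then n%:R else 0.
Proof.
move=> h; under eq_bigr do rewrite exprAC; case: ifPn => d.
  have /eqP -> : x ^+ k == 1 by rewrite -(prim_order_dvd h).
  by under eq_bigr do rewrite expr1n; rewrite sumr_const card_ord.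
have x1 : x ^+ k - 1 != 0 by rewrite subr_eq0 -(prim_order_dvd h).
by apply: (mulfI x1); rewrite -subrX1 exprAC (prim_expr_order h) expr1n subrr mulr0.
Qed.

(** Discrete Cauchy formula: the exponent [n - m] stands for -m. Only the index m survives, because
    indices below n that are congruent modulo n are equal. *)
Lemma coef_mean (p : {poly C}) n x (r : C) m : n.-primitive_root x ->
  (size p <= n)%N -> (m < n)%N ->
  \sum_(j < n) p.[r * x ^+ j] * (x ^+ j) ^+ (n - m) = n%:R * (p`_m * r ^+ m).
Proof.
move=> h sp mn; transitivity (\sum_(i < n) (p`_i * r ^+ i) * \sum_(j < n) (x ^+ j) ^+ (i +
  (n - m))).
  under eq_bigr => j _ do rewrite (horner_coef_wide _ sp) big_distrl /=.
  rewrite exchange_big /=; apply: eq_bigr => i _; rewrite big_distrr /=.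
  by apply: eq_bigr => j _; rewrite exprMn exprD; ring.
rewrite (bigD1 (Ordinal mn)) //= [X in _ + X]big1 => [|i im].
  by rewrite (sum_prim_root_exp _ h) subnKC ?dvdnn ?addr0 1?mulrC // ltnW.
rewrite (sum_prim_root_exp _ h) ifF ?mulr0 //; apply/negbTE.
have -> : (n %| i + (n - m))%N = (i + n == m + n %[mod n])%N.
  have -> : (i + n = i + (n - m) + m)%N by rewrite -addnA subnK // ltnW.
  by rewrite [(m + n)%N]addnC eqn_modDr modnn.
by rewrite !modnDr !modn_small //; apply: contra im => /eqP e; apply/eqP/val_inj.
Qed.

Lemma coef_bound (p : {poly C}) (r M : R) m : 0 <= r ->
  (forall z, cmod z <= r -> cmod p.[z] <= M) -> cmod p`_m * r ^+ m <= M.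
Proof.
move=> r0 h; pose n := maxn (size p) m.+1.
have n0 : (0 < n)%N by rewrite /n leq_max orbT.
have [x hx] := prim_root_exists C n0; have nx := cmod_prim_root hx.
have := coef_mean r%:C hx (leq_maxl _ _) (leq_maxr _ _).
move/(congr1 (@cmod R)); rewrite !cmodM cmod_nat cmodX cmodr (ger0_norm r0) => E.
have n0' : 0 < (n%:R : R) by rewrite ltr0n.
rewrite -(ler_pM2l n0') -E (le_trans (cmod_sum _ _ _)) //.
rewrite (@le_trans _ _ (\sum_(j < n) M)) //; last first.
  by rewrite sumr_const card_ord mulr_natl.
apply: ler_sum => j _; rewrite cmodM !cmodX nx !expr1n mulr1 h //.
by rewrite cmodM cmodX nx expr1n mulr1 cmodr ger0_norm.
Qed.

Lemma sqr_cmodD z w : cmod (z + w) ^+ 2 = cmod z ^+ 2 + cmod w ^+ 2 + 2 * Re (z^* * w).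
Proof. by rewrite !sqr_cmod; case: z w => [a b] [c d] /=; ring. Qed.

(** Parseval's identity for a linear polynomial; the cross term is a sum over all n-th roots of
    unity, which vanishes for n > 1. *)
Lemma sum_sqr_cmod n x z w : n.-primitive_root x -> (1 < n)%N ->
  \sum_(j < n) cmod (z + w * x ^+ j) ^+ 2 = n%:R * (cmod z ^+ 2 + cmod w ^+ 2).
Proof.
move=> h n1; have nx := cmod_prim_root h.
under eq_bigr do rewrite sqr_cmodD cmodM cmodX nx expr1n mulr1.
rewrite big_split /= sumr_const card_ord -[_ *+ n]mulr_natl.
suff -> : \sum_(j < n) 2 * Re (z^* * (w * x ^+ j)) = 0 by rewrite addr0.
rewrite -big_distrr /= -raddf_sum /=.
suff -> : \sum_(j < n) z^* * (w * x ^+ j) = 0 by rewrite mulr0.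
rewrite -!big_distrr /=; under eq_bigr do rewrite -[x ^+ _]expr1.
by rewrite (sum_prim_root_exp _ h) dvdn1 gtn_eqF // !mulr0.
Qed.

(** The quantity on the left is the coefficient of t^2 in p(rt) (q0 + q1 t) (u2 + u1 t), computed as
    an average over roots of unity. The two linear factors are separated by AB <= (A^2 + B^2)/2, and
    Parseval's identity evaluates the averages of their squares. *)
Lemma toeplitz_bound (p : {poly C}) (r M : R) (q0 q1 u1 u2 : C) : 0 <= r ->
  (forall z, cmod z <= r -> cmod p.[z] <= M) -> p`_0 = 0 ->
  cmod ((q0 * u1 + q1 * u2) * (p`_1 * r%:C) + q0 * u2 * (p`_2 * r%:C ^+ 2)) <=
  M * ((cmod q0 ^+ 2 + cmod q1 ^+ 2 + cmod u1 ^+ 2 + cmod u2 ^+ 2) / 2).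
Proof.
move=> r0 h p0; pose n := maxn (size p) 3.
have n3 : (2 < n)%N by rewrite leq_maxr.
have n0 : (0 < n)%N by apply: leq_ltn_trans n3.
have n1 : (1 < n)%N by apply: leq_ltn_trans n3.
have sp : (size p <= n)%N by rewrite leq_maxl.
have [x hx] := prim_root_exists C n0; have nx := cmod_prim_root hx.
have n0' : 0 < (n%:R : R) by rewrite ltr0n.
have M0 : 0 <= M by apply: le_trans (h 0 _); rewrite ?cmod_ge0 ?cmod0.
rewrite -(ler_pM2l n0') -cmod_nat -cmodM.
have -> : n%:R * ((q0 * u1 + q1 * u2) * (p`_1 * r%:C) + q0 * u2 * (p`_2 * r%:C ^+ 2)) =
  \sum_(j < n) p.[r%:C * x ^+ j] * (q0 + q1 * x ^+ j) * ((u2 + u1 * x ^+ j) * (x ^+ j) ^+ (n - 2)).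
  have E0 := coef_mean r%:C hx sp n0; have E1 := coef_mean r%:C hx sp n1.
  have E2 := coef_mean r%:C hx sp n3; rewrite p0 mul0r mulr0 in E0.
  transitivity ((q1 * u1) * 0 + (q0 * u1 + q1 * u2) * (n%:R * (p`_1 * r%:C ^+ 1)) +
    (q0 * u2) * (n%:R * (p`_2 * r%:C ^+ 2))); first by ring.
  rewrite -E1 -E2 -[X in _ * X + _ + _]E0 !big_distrr -!big_split /=; apply: eq_bigr => j _.
  have -> : (n - 0 = (n - 2).+2)%N by rewrite subn0 -addn2 subnK // ltnW.
  have -> : (n - 1 = (n - 2).+1)%N by rewrite -subSn ?subSS // ltnW.
  by rewrite !exprS; ring.
rewrite (le_trans (cmod_sum _ _ _)) // cmod_nat.
rewrite (@le_trans _ _ (\sum_(j < n) M / 2 * (cmod (q0 + q1 * x ^+ j) ^+ 2 + cmod (u2 + u1 * x ^+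
  j) ^+ 2))) //.
  apply: ler_sum => j _; rewrite !cmodM !cmodX nx !expr1n mulr1.
  have : cmod p.[r%:C * x ^+ j] <= M.
    by apply: h; rewrite cmodM cmodX nx expr1n mulr1 cmodr ger0_norm.
  move: (cmod_ge0 (q0 + q1 * x ^+ j)) (cmod_ge0 (u2 + u1 * x ^+ j)) (cmod_ge0 p.[r%:C * x ^+ j]).
  move: (cmod (q0 + q1 * x ^+ j)) (cmod (u2 + u1 * x ^+ j)) (cmod p.[r%:C * x ^+
    j]) => A B D A0 B0 D0 DM.
  have AB : 0 <= A * B by rewrite mulr_ge0.
  have s := sqr_ge0 (A - B).
  rewrite -mulrA (@le_trans _ _ (M * (A * B))) ?ler_wpM2r //; nra.
rewrite -big_distrr /= big_split /= !(sum_sqr_cmod _ _ hx n1).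
by apply: eq_ler; field.
Qed.

(** Lets the radius 1 - e and the bound 1 + e tend to 1 together; the restriction on e keeps the
    radius positive. *)
Lemma le_of_small_perturb (x y k : R) :
  (forall e, 0 < e -> e <= 1 / 2 -> x <= y + e * k) -> x <= y.
Proof.
move=> h; apply/ler_addgt0Pr => d d0.
pose m := `|k| + d + 1; have k0 := normr_ge0 k; have kk := ler_norm k.
have m0 : 0 < m by rewrite /m; lra.
pose e := d / (2 * m); have e0 : 0 < e by rewrite divr_gt0 // mulr_gt0.
have em : e * (2 * m) = d by rewrite divfK // gt_eqF // mulr_gt0.
have e1 : e <= 1 / 2 by rewrite /m in em; nra.
by apply: (le_trans (h e e0 e1)); rewrite lerD2l /m in em *; nra.
Qed.

(* The matrix [[c_1, 0], [c_2, c_1]] is a contraction: in toeplitz_bound, (u1, u2) is the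
   conjugate of the image of (q0, q1), and then r and M tend to 1. *)
Lemma toeplitz_contraction c (q0 q1 : C) : rad_ge1 c -> c 0%N = 0 ->
  (forall z, cmod z < 1 -> cmod (pser c z) < 1) ->
  cmod (c 1%N * q0) ^+ 2 + cmod (c 1%N * q1 + c 2%N * q0) ^+ 2 <= cmod q0 ^+ 2 + cmod q1 ^+ 2.
Proof.
move=> gc c0 hc.
set u1 := c 1%N * q0; set u2 := c 1%N * q1 + c 2%N * q0.
set T := cmod u1 ^+ 2 + cmod u2 ^+ 2; set S := cmod q0 ^+ 2 + cmod q1 ^+ 2.
suff : T <= (S + T) / 2 by lra.
pose X := (q0 * u1^* + q1 * u2^*) * c 1%N; pose Y := q0 * u2^* * c 2%N.
have XY : X + Y = T%:C.
  by rewrite rmorphD /= -!mulrJ /X /Y /u1 /u2; ring.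
(* The three terms pay for the bound 1 + e on the polynomial, for 1 - r = e and for 1 - r^2 <=
   2e. *)
apply: (@le_of_small_perturb _ _ ((S + T) / 2 + cmod X + 2 * cmod Y)) => e e0 e1.
pose r := 1 - e; have r0 : 0 <= r by rewrite /r; lra.
have r1 : r < 1 by rewrite /r; lra.
have [K [q [K0 qq0 qq1 h]]] := pser_psum_dist gc r0 r1.
have [N hN] := geo_small K0 qq0 qq1 e0.
pose n := maxn N 3.
have n3 : (2 < n)%N by rewrite leq_maxr.
have B z : cmod z <= r -> cmod (psum c n).[z] <= 1 + e.
  move=> zr; rewrite -[_.[z]](subrK (pser c z)) (le_trans (cmodD _ _)) // addrC lerD //.
    by rewrite ltW // hc // (le_lt_trans zr).
  by rewrite cmodBC (le_trans (h z zr n)) // hN // leq_maxl.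
have coefn k : (k < n)%N -> (psum c n)`_k = c k by move=> kn; rewrite coef_poly kn.
have := toeplitz_bound q0 q1 u1^* u2^* r0 B.
rewrite !coefn // ?(ltnW n3) ?(ltnW (ltnW n3)) //.
move=> /(_ c0); rewrite !cmod_conj -/S.
have -> : (q0 * u1^* + q1 * u2^*) * (c 1%N * r%:C) + q0 * u2^* * (c 2%N * r%:C ^+ 2) = X * r%:C +
  Y * (r ^+ 2)%:C.
  by rewrite rmorphXn /X /Y /=; ring.
have -> : S + cmod u1 ^+ 2 + cmod u2 ^+ 2 = S + T by rewrite /T addrA.
have <- : cmod (X + Y) = T by rewrite XY cmodr ger0_norm // addr_ge0 // sqr_ge0.
set T' := cmod (X + Y).
have : T' <= cmod (X * r%:C + Y * (r ^+ 2)%:C) + (cmod X * e + cmod Y * (1 - r ^+ 2)).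
  have -> : cmod X * e + cmod Y * (1 - r ^+ 2) = cmod (X * e%:C) + cmod (Y * (1 - r ^+ 2)%:C).
    rewrite !cmodM !cmodr (gtr0_norm e0) ger0_norm //.
    by rewrite subr_ge0 expr_le1 // ltW.
  rewrite (le_trans _ (lerD (lexx _) (cmodD _ _))) // (le_trans _ (cmodD _ _)) // /T'.
  apply: eq_ler; congr cmod.
  by rewrite /r !(rmorphB, rmorphXn, rmorph1) /=; ring.
have := cmod_ge0 Y; have := cmod_ge0 X; rewrite /r; nra.
Qed.

Lemma schwarz_pick_coef c : rad_ge1 c -> c 0%N = 0 ->
  (forall z, cmod z < 1 -> cmod (pser c z) < 1) ->
  cmod (c 1%N) <= 1 /\ cmod (c 2%N) <= 1 - cmod (c 1%N) ^+ 2.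
Proof.
move=> gc c0 hc.
have H := fun q0 q1 => toeplitz_contraction q0 q1 gc c0 hc.
set x := cmod (c 1%N); set y := cmod (c 2%N).
have x0 : 0 <= x := cmod_ge0 _; have y0 : 0 <= y := cmod_ge0 _.
have x1 : x <= 1.
  have := H 1 0; rewrite !mulr0 !mulr1 add0r cmod1 cmod0 -/x -/y expr0n expr1n /=; nra.
have J : cmod (c 1%N * ((c 1%N)^* * c 2%N)) = x ^+ 2 * y.
  by rewrite !cmodM cmod_conj -/x -/y; ring.
split=> //; have [x1E|xn1] := eqVneq x 1.
  (* For |c_1| = 1 this vector doubles c_2: 1 + 4 y^2 <= 1 + y^2 forces y = 0. The vector used in
     the other case would have first entry 0 here. *)
  have := H 1 ((c 1%N)^* * c 2%N).
  rewrite !mulr1 mulrA mulrJ cmod1 cmodM cmod_conj -/x -/y x1E !expr1n !mul1r.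
  by rewrite -mulr2n -mulr_natr cmodM cmod_nat -/y => ?; nra.
have d : 0 < 1 - x ^+ 2.
  have : 0 < 1 - x by rewrite subr_gt0 lt_neqAle xn1.
  by move=> ?; nra.
(* This vector extremizes the contraction inequality. *)
have := H (1 - x ^+ 2)%:C ((c 1%N)^* * c 2%N).
rewrite mulrA mulrJ -/x [c 2%N * _]mulrC -mulrDl -rmorphD /= [x ^+ 2 + _]addrC subrK mul1r.
rewrite !cmodM cmod_conj cmodr (gtr0_norm d) -/x -/y => h.
have : y ^+ 2 * (1 - x ^+ 2) <= (1 - x ^+ 2) ^+ 2 * (1 - x ^+ 2) by nra.
rewrite ler_pM2r // => h2.
by rewrite -(ler_pXn2r (n := 2)) ?nnegrE // ltW.
Qed.
End S3.

(** * Locally uniform limits of polynomials *)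

Section S4.
Local Open Scope classical_set_scope.
Local Open Scope ring_scope.
Local Open Scope complex_scope.
Variable R : realType.
Local Notation C := R[i].
Local Notation Re := (@complex.Re R).
Local Notation Im := (@complex.Im R).
Implicit Types (z w : C) (a b c : nat -> C).

(** Stands for analyticity on the open disk: [weierstrass] recovers a power series from it and
    [papprox_pser] is the converse. *)
Definition papprox (g : C -> C) : Prop := forall r : R, 0 <= r -> r < 1 ->
  forall e : R, 0 < e -> exists p : {poly C}, forall z, cmod z <= r -> cmod (g z - p.[z]) <= e.

Lemma cmod_coef_le (p : {poly C}) k : cmod p`_k <= \sum_(j < size p) cmod p`_j.
Proof.
have [kp|pk] := ltnP k (size p); last first.
  by rewrite nth_default // cmod0 sumr_ge0 // => *; exact: cmod_ge0.
by rewrite (bigD1 (Ordinal kp)) //= lerDl sumr_ge0 // => *; exact: cmod_ge0.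
Qed.

Lemma cmod_horner_le (p : {poly C}) z : cmod z <= 1 -> cmod p.[z] <= \sum_(j < size p) cmod p`_j.
Proof.
move=> z1; rewrite horner_coef (le_trans (cmod_sum _ _ _)) //; apply: ler_sum => j _.
by rewrite cmodM cmodX ler_piMr ?cmod_ge0 // exprn_ile1 ?cmod_ge0.
Qed.

(** Let P_n be within 1/(n+1) of g on the disk of radius 1 - 1/(n+1). Cauchy's estimate for P_n -
    P_m makes each coefficient a Cauchy sequence in n, and the same estimate, passed to the limit in
    m, compares P_n with the limit series. *)
Lemma weierstrass g : papprox g ->
  exists b, rad_ge1 b /\ forall z, cmod z < 1 -> pser b z = g z.
Proof.
move=> hg; pose e n : R := n.+1%:R^-1; pose r n : R := 1 - e n.
have e0 n : 0 < e n by rewrite invr_gt0 ltr0n.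
have e1 n : e n <= 1 by rewrite invf_le1 ?ltr0n // ler1n.
have emono n m : (n <= m)%N -> e m <= e n by move=> le_nm; rewrite lef_pV2 ?posrE ?ltr0n // ler_nat.
have esmall d : 0 < d -> exists N, forall n, (N <= n)%N -> e n <= d.
  move=> d0; exists (Num.trunc d^-1) => n Nn; apply: le_trans (emono _ _ Nn) _.
  rewrite -[leRHS]invrK lef_pV2 ?posrE ?ltr0n ?invr_gt0 //.
  by rewrite ltW // truncnS_gt.
have r0 n : 0 <= r n by rewrite /r; have := e1 n; lra.
have r1 n : r n < 1 by rewrite /r; have := e0 n; lra.
have /choice [P hP] n := hg (r n) (r0 n) (r1 n) (e n) (e0 n).
have cd n m k : (n <= m)%N -> cmod ((P n)`_k - (P m)`_k) * r n ^+ k <= 2 * e n.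
  move=> le_nm; rewrite -coefB; apply: coef_bound => // z zr; rewrite hornerD hornerN.
  rewrite (le_trans (cmod_triB _ (g z) _)) //.
  have zr' : cmod z <= r m by apply: le_trans zr _; rewrite /r; have := emono n m le_nm; lra.
  have := hP m z zr'; have := hP n z zr; rewrite cmodBC; have := emono n m le_nm; lra.
have cvgP k : cvgn (fun n => (P n)`_k).
  apply: cauchyC => d d0.
  have p0 : (0 : R) < 2^-1 ^+ k by rewrite exprn_gt0 // invr_gt0.
  have [N hN] := esmall (d * 2^-1 ^+ k / 2) ltac:(by rewrite divr_gt0 // mulr_gt0).
  (* [r 0] is 0, so [cd] carries no information there for k > 0; from index 1 on the radius is at
     least 1/2. *)
  exists (maxn N 1) => n Nn.
  have := hN _ (leq_maxl N 1); have := cd _ _ k Nn; set M := maxn N 1 => A B.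
  have rM : 2^-1 <= r M.
    have : e M <= e 1 by rewrite emono // leq_maxr.
    have -> : e 1 = 2^-1 by [].
    by rewrite /r; lra.
  have : 2^-1 ^+ k <= r M ^+ k by rewrite lerXn2r ?nnegrE // invr_ge0.
  rewrite cmodBC; have := cmod_ge0 ((P M)`_k - (P n)`_k); move: A B; nra.
pose b k := limn (fun n => (P n)`_k).
have hb k : (fun n => (P n)`_k) @ \oo --> b k := cvgP k.
have cb n k : cmod ((P n)`_k - b k) * r n ^+ k <= 2 * e n.
  apply/ler_addgt0Pr => d d0; have [N hN] := (cvgnCP _ _).1 (hb k) d d0.
  have rk : r n ^+ k <= 1 by rewrite exprn_ile1 // ltW.
  have rk0 : 0 <= r n ^+ k by rewrite exprn_ge0.
  rewrite (@le_trans _ _ ((cmod ((P n)`_k - (P (maxn n N))`_k) +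
    cmod ((P (maxn n N))`_k - b k)) * r n ^+ k)) //.
    by rewrite ler_wpM2r // cmod_triB.
  rewrite mulrDl lerD ?cd ?leq_maxl // (le_trans _ (hN (maxn n N) (leq_maxr _ _))) //.
  by rewrite ler_piMr ?cmod_ge0.
have gb : rad_ge1 b.
  move=> s s0 s1; have [n hn] := esmall (1 - s) ltac:(lra).
  have sr : s <= r n by have := hn n (leqnn _); rewrite /r; lra.
  exists (\sum_(j < size (P n)) cmod (P n)`_j + 2) => k.
  have h1 : s ^+ k <= r n ^+ k by rewrite lerXn2r ?nnegrE // ltW.
  have h2 : r n ^+ k <= 1 by rewrite exprn_ile1 // ltW.
  have h0 : 0 <= s ^+ k by rewrite exprn_ge0 // ltW.
  have := cb n k; have := cmod_coef_le (P n) k; have := e1 n.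
  have := cmodB (P n)`_k ((P n)`_k - b k); rewrite opprB addrC subrK.
  have := cmod_ge0 (b k); have := cmod_ge0 ((P n)`_k - b k); have := cmod_ge0 (P n)`_k.
  nra.
exists b; split=> // z z1; apply: pser_uniq => d d0.
pose s := cmod z; pose t := (s + 1) / 2; pose q := s / t.
have s0 : 0 <= s := cmod_ge0 z.
have t0 : 0 < t by rewrite /t; lra.
have t1 : t < 1 by rewrite /t /s; lra.
have q0 : 0 <= q by rewrite divr_ge0 // ltW.
have q1 : q < 1 by rewrite ltr_pdivrMr // mul1r /t /s; lra.
(* The coefficient errors 2 e_n t^-k, weighted by s^k, sum to at most 2 e_n / (1 - q); the
   additional 1 is for the distance from P_n to g. *)
pose G := 2 / (1 - q) + 1.
have G0 : 0 < G by rewrite addr_gt0 // divr_gt0 // subr_gt0.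
have [N1 hN1] := esmall (1 - t) ltac:(lra).
have [N2 hN2] := esmall (d / G) (divr_gt0 d0 G0).
pose n := maxn N1 N2.
have tr : t <= r n by have := hN1 n (leq_maxl _ _); rewrite /r; lra.
have en : e n * G <= d by rewrite -ler_pdivlMr // hN2 // leq_maxr.
have zr : cmod z <= r n by apply: le_trans tr; rewrite /t /s; lra.
exists (size (P n)) => m le_nm; rewrite (le_trans (cmod_triB _ (P n).[z] _)) //.
apply: le_trans en; rewrite /G mulrDr mulr1 lerD //; last by rewrite cmodBC hP.
rewrite horner_poly (horner_coef_wide _ le_nm) -sumrB (le_trans (cmod_sum _ _ _)) //.
rewrite (@le_trans _ _ (\sum_(k < m) 2 * e n * q ^+ k)) //.
  apply: ler_sum => k _; rewrite -mulrBl cmodM cmodX cmodBC -/s.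
  have -> : s ^+ k = t ^+ k * q ^+ k by rewrite -exprMn /q mulrC divfK // gt_eqF.
  rewrite mulrA ler_wpM2r ?exprn_ge0 // (le_trans _ (cb n k)) //.
  by rewrite ler_wpM2l ?cmod_ge0 // lerXn2r ?nnegrE // ltW.
rewrite -big_distrr /= -(big_mkord xpredT (fun k => q ^+ k)).
have := geo_sum_le 0 m q0 q1; rewrite expr0 => h.
rewrite -[2 * e n * _]mulrA mulrCA ler_wpM2l ?(ltW (e0 n)) //.
by rewrite ler_wpM2l // -[leRHS]mul1r.
Qed.

Lemma papprox_eq g h : (forall z, cmod z < 1 -> g z = h z) -> papprox g -> papprox h.
Proof.
move=> gh hg r r0 r1 e e0; have [p hp] := hg r r0 r1 e e0.
by exists p => z zr; rewrite -gh ?hp // (le_lt_trans zr).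
Qed.

Lemma papprox_poly (p : {poly C}) : papprox (fun z => p.[z]).
Proof. by move=> r r0 r1 e e0; exists p => z _; rewrite subrr cmod0 ltW. Qed.

Lemma papprox_cst (k : C) : papprox (fun=> k).
Proof.
apply: papprox_eq (papprox_poly k%:P) => z _; by rewrite hornerC.
Qed.

Lemma papproxD g h : papprox g -> papprox h -> papprox (fun z => g z + h z).
Proof.
move=> hg hh r r0 r1 e e0.
have [p hp] := hg r r0 r1 (e / 2) ltac:(lra).
have [q hq] := hh r r0 r1 (e / 2) ltac:(lra).
exists (p + q) => z zr; rewrite hornerD.
have -> : g z + h z - (p.[z] + q.[z]) = (g z - p.[z]) + (h z - q.[z]) by ring.
by rewrite (le_trans (cmodD _ _)) //; have := hp z zr; have := hq z zr; lra.
Qed.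

Lemma papprox_bounded g (r : R) : papprox g -> 0 <= r -> r < 1 ->
  exists2 M, 0 <= M & forall z, cmod z <= r -> cmod (g z) <= M.
Proof.
move=> hg r0 r1; have [p hp] := hg r r0 r1 1 ltr01.
exists (\sum_(j < size p) cmod p`_j + 1).
  by rewrite addr_ge0 // sumr_ge0 // => *; exact: cmod_ge0.
move=> z zr; rewrite -[g z](subrK p.[z]) (le_trans (cmodD _ _)) // addrC lerD ?hp //.
by rewrite cmod_horner_le // (le_trans zr) // ltW.
Qed.

Lemma papproxM g h : papprox g -> papprox h -> papprox (fun z => g z * h z).
Proof.
move=> hg hh r r0 r1 e e0.
have [M M0 hM] := papprox_bounded hg r0 r1.
have [N N0 hN] := papprox_bounded hh r0 r1.
(* As d <= 1, the approximant of [h] is bounded by N + 1, and the error of the product is at most d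
   (N + 1) + M d. *)
pose d := Num.min 1 (e / (M + N + 1)).
have S0 : 0 < M + N + 1 by lra.
have d0 : 0 < d by rewrite lt_min ltr01 divr_gt0.
have d1 : d <= 1 by rewrite ge_min lexx.
have de : d * (M + N + 1) <= e by rewrite -ler_pdivlMr // ge_min lexx orbT.
have [p hp] := hg r r0 r1 d d0.
have [q hq] := hh r r0 r1 d d0.
exists (p * q) => z zr; rewrite hornerM.
have -> : g z * h z - p.[z] * q.[z] = (g z - p.[z]) * (h z - (h z - q.[z])) + g z * (h z - q.[z])
  by ring.
rewrite (le_trans (cmodD _ _)) // !cmodM.
have := cmodB (h z) (h z - q.[z]).
have := hp z zr; have := hq z zr; have := hM z zr; have := hN z zr.
move: (cmod_ge0 (g z - p.[z])) (cmod_ge0 (h z - q.[z])) (cmod_ge0 (g z)).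
move: (cmod_ge0 (h z)) (cmod_ge0 (h z - (h z - q.[z]))).
set A := cmod (g z - _); set B := cmod (h z - q.[z]); set D := cmod (g z); set E := cmod (h z);
  set F := cmod _.
move=> E0 F0 A0 B0 D0 h1 h2 h3 h4 h5.
have : A * F <= d * (N + 1) by apply: ler_pM => //; lra.
have : D * B <= M * d by apply: ler_pM.
nra.
Qed.

Lemma papproxX g n : papprox g -> papprox (fun z => g z ^+ n).
Proof.
move=> hg; elim: n => [|n IH].
  by apply: papprox_eq (papprox_cst 1) => z _; rewrite expr0.
by apply: papprox_eq (papproxM hg IH) => z _; rewrite exprS.
Qed.

Lemma papprox_lim g :
  (forall r : R, 0 <= r -> r < 1 -> forall e : R, 0 < e ->
     exists2 h, papprox h & forall z, cmod z <= r -> cmod (g z - h z) <= e) -> papprox g.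
Proof.
move=> H r r0 r1 e e0.
have [h hh gh] := H r r0 r1 (e / 2) ltac:(lra).
have [p hp] := hh r r0 r1 (e / 2) ltac:(lra).
exists p => z zr; rewrite (le_trans (cmod_triB _ (h z) _)) //.
by have := gh z zr; have := hp z zr; lra.
Qed.

Lemma papprox_pser a : rad_ge1 a -> papprox (pser a).
Proof.
move=> ga; apply: papprox_lim => r r0 r1 e e0.
have [K [q [K0 q0 q1 h]]] := pser_psum_dist ga r0 r1.
have [N hN] := geo_small K0 q0 q1 e0.
exists (fun z => (psum a N).[z]); first exact: papprox_poly.
by move=> z zr; rewrite (le_trans (h z zr N)) // hN.
Qed.
End S4.

(** * The complex exponential *)

Section S5.
Local Open Scope classical_set_scope.
Local Open Scope ring_scope.
Local Open Scope complex_scope.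
Variable R : realType.
Local Notation C := R[i].
Local Notation Re := (@complex.Re R).
Local Notation Im := (@complex.Im R).
Implicit Types (z w : C) (a b c : nat -> C).

Lemma cexpD z w : cexp (z + w) = cexp z * cexp w.
Proof.
case: z w => [x y] [u v]; rewrite /cexp /= expRD cosD sinD.
by apply/eqP; rewrite eq_complex /=; apply/andP; split; apply/eqP; ring.
Qed.

Lemma cexp0 : cexp 0 = 1 :> C.
Proof. by rewrite /cexp /= expR0 cos0 sin0 mulr1 mulr0. Qed.

Lemma cexpN z : cexp z * cexp (- z) = 1.
Proof. by rewrite -cexpD subrr cexp0. Qed.

Lemma cexpMn z n : cexp (z *+ n) = cexp z ^+ n.
Proof. by elim: n => [|n IH]; rewrite ?mulr0n ?cexp0 // mulrS cexpD IH exprS. Qed.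

Lemma cmod_cexp z : cmod (cexp z) = expR (Re z).
Proof.
case: z => x y; rewrite cmodE /cexp /= !exprMn -mulrDr cos2Dsin2 mulr1 sqrtr_sqr.
by rewrite gtr0_norm // expR_gt0.
Qed.

Lemma cexp_neq0 z : cexp z != 0.
Proof.
apply/eqP => h; have := cmod_cexp z; rewrite h cmod0 => /esym/eqP.
by rewrite expR_eq0.
Qed.

Lemma sin_le (y : R) : `|sin y| <= `|y|.
Proof.
have pos (x : R) : 0 <= x -> `|sin x| <= x.
  move=> x0; have [] := @MVT_segment R (@sin R) (@cos R) 0 x x0 (fun t _ => is_derive_sin t).
    by apply: continuous_subspaceT => ?; exact: continuous_sin.
  move=> c _; rewrite sin0 !subr0 => ->; rewrite normrM (ger0_norm x0).
  by rewrite ler_piMl // cos_max.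
have [y0|/ltW y0] := leP 0 y; first by rewrite (ger0_norm y0) pos.
by rewrite -normrN -sinN (ler0_norm y0) pos // oppr_ge0.
Qed.

Lemma cos_ge (y : R) : 1 - y ^+ 2 / 2 <= cos y.
Proof.
have -> : cos y = 1 - 2 * sin (y / 2) ^+ 2.
  rewrite {1}(_ : y = (y / 2) *+ 2); last by rewrite -mulr_natr divfK // pnatr_eq0.
  by rewrite cos_mulr2n cos2sin2; ring.
have := sin_le (y / 2); rewrite -(ler_pXn2r (n := 2)) ?nnegrE //.
by rewrite !real_normK ?num_real //; lra.
Qed.

Lemma sin_sub_le (y : R) : `|y| <= 1 -> `|sin y - y| <= y ^+ 2.
Proof.
have pos (x : R) : 0 <= x -> x <= 1 -> `|sin x - x| <= x ^+ 2.
  move=> x0 x1; have [] := @MVT_segment R (@sin R) (@cos R) 0 x x0 (fun t _ => is_derive_sin t).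
    by apply: continuous_subspaceT => ?; exact: continuous_sin.
  move=> c; rewrite in_itv /= => /andP[c0 cx]; rewrite sin0 !subr0 => ->.
  have := cos_ge c; have := cos_le1 c => A B; rewrite ler_norml.
  have cc : c ^+ 2 <= x by nra.
  by apply/andP; split; nra.
have [y0|/ltW y0] := leP 0 y; first by rewrite (ger0_norm y0) => /pos ->.
rewrite (ler0_norm y0) => y1; have := pos (- y); rewrite sinN oppr_ge0 sqrrN -opprD normrN.
by move=> /(_ y0 y1).
Qed.

(** Both sides come from 1 + t <= e^t: t = x gives the lower one, and t = -x gives e^x (1 - x) <= 1,
    hence the upper one. *)
Lemma expR_quad (x : R) : `|x| <= 1 / 2 -> `|expR x - 1 - x| <= 2 * x ^+ 2.
Proof.
rewrite ler_norml => /andP[h1 h2]; have A := expR_ge1Dx x.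
have B := expR_ge1Dx (- x); have D := expRxMexpNx_1 x; have E := expR_gt0 x.
have F : expR x * (1 - x) <= 1 by rewrite -[leRHS]D ler_wpM2l // ltW.
rewrite ger0_norm; last by lra.
suff : expR x * (1 - x) <= (1 + x + 2 * x ^+ 2) * (1 - x).
  by rewrite ler_pM2r; lra.
by apply: (le_trans F); nra.
Qed.

(** The only analytic input on the exponential: it yields the convergence of (1 + u/n)^n and, later,
    the first Taylor coefficient. *)
Lemma cexp_quad z : cmod z <= 1 / 2 -> cmod (cexp z - 1 - z) <= 3 * cmod z ^+ 2.
Proof.
move=> h; have := Re_le_nm z; have := Im_le_nm z; rewrite sqr_cmod.
have := cmod_le_ReIm (cexp z - 1 - z).
case: z h => x y; move: (cmod (x +i* y)) => r rh; rewrite /cexp /= => T yr xr;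
  rewrite oppr0 addr0 in T.
have X := expR_quad (le_trans xr rh).
have r1 : r <= 1 by lra.
have Y := sin_sub_le (le_trans yr r1).
have S := sin_le y; have K := cos_ge y; have K1 := cos_le1 y.
have x2 : `|x| <= 1 / 2 by lra.
apply: (le_trans T).
(* The real part costs 2x^2 + y^2 and the imaginary part (x^2 + y^2) + y^2, whence the constant
   3. *)
have -> : expR x * cos y - 1 - x = (expR x - 1 - x) + expR x * (cos y - 1) by ring.
have -> : expR x * sin y - y = (expR x - 1) * sin y + (sin y - y) by ring.
have e2 : expR x <= 2.
  by move: X; rewrite ler_norml => /andP[]; move: x2; rewrite ler_norml => /andP[]; nra.
have t1 : `|expR x * (cos y - 1)| <= y ^+ 2.
  rewrite normrM (ger0_norm (expR_ge0 x)) ler0_norm ?subr_le0 //.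
  have := expR_ge0 x; nra.
have ex1 : `|expR x - 1| <= 2 * `|x|.
  have : `|expR x - 1| <= `|expR x - 1 - x| + `|x|.
    by rewrite (le_trans _ (ler_normD _ _)) // subrK.
  move: X; rewrite -(real_normK (num_real x)); have := normr_ge0 x; nra.
have t2 : `|(expR x - 1) * sin y| <= x ^+ 2 + y ^+ 2.
  rewrite normrM (@le_trans _ _ (2 * `|x| * `|y|)) ?ler_pM //.
  rewrite -(real_normK (num_real x)) -(real_normK (num_real y)).
  have := sqr_ge0 (`|x| - `|y|); nra.
rewrite (le_trans (lerD (ler_normD _ _) (ler_normD _ _))) //.
move: X Y t1 t2; nra.
Qed.

(** Having B^n in place of B^(n-1), harmless for B >= 1, allows an induction without
    predecessors. *)
Lemma cmod_subX (z w : C) (B : R) n : cmod z <= B -> cmod w <= B -> 1 <= B ->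
  cmod (z ^+ n - w ^+ n) <= n%:R * cmod (z - w) * B ^+ n.
Proof.
move=> zB wB B1; elim: n => [|n IH]; first by rewrite subrr cmod0 !mul0r.
have -> : z ^+ n.+1 - w ^+ n.+1 = z * (z ^+ n - w ^+ n) + (z - w) * w ^+ n by rewrite !exprS; ring.
rewrite (le_trans (cmodD _ _)) // !cmodM cmodX -natr1 !mulrDl mul1r lerD //.
  apply: (@le_trans _ _ (B * (n%:R * cmod (z - w) * B ^+ n))); first by rewrite ler_pM ?cmod_ge0.
  by apply: eq_ler; rewrite exprS; ring.
rewrite ler_wpM2l ?cmod_ge0 // (@le_trans _ _ (B ^+
  n)) ?lerXn2r ?nnegrE ?cmod_ge0 ?(le_trans ler01) //.
by rewrite ler_weXn2l.
Qed.

(* Polynomial approximation through (1 + g/n)^n --> exp g. *)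
Lemma papprox_cexp (g : C -> C) : papprox g -> papprox (fun z => cexp (g z)).
Proof.
move=> hg; apply: papprox_lim => r r0 r1 e e0.
have [M M0 hM] := papprox_bounded hg r0 r1.
(* The first threshold puts |g/n| below 1/2, where [cexp_quad] applies; the second makes n * 3
   (M/n)^2 * e^M at most e, where e^M is the n-th power of the common bound e^(M/n). *)
pose K := Num.max (2 * M) (3 * M ^+ 2 * expR M / e).
pose n := (Num.trunc K).+1.
have n0 : 0 < (n%:R : R) by rewrite ltr0n.
have nn0 : (n%:R : C) != 0 by rewrite pnatr_eq0.
have Kn : K <= n%:R by rewrite ltW // truncnS_gt.
have n1 : M / n%:R <= 1 / 2.
  rewrite ler_pdivrMr //; suff : 2 * M <= n%:R by lra.
  by apply: le_trans Kn; rewrite le_max lexx.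
have n2 : 3 * M ^+ 2 * expR M <= e * n%:R.
  rewrite [e * _]mulrC -ler_pdivrMr //; apply: le_trans Kn.
  by rewrite le_max lexx orbT.
exists (fun z => (1 + g z * n%:R^-1) ^+ n).
  apply: papproxX; apply: papproxD; first exact: papprox_cst.
  by apply: papproxM => //; exact: papprox_cst.
move=> z zr; set u := g z * n%:R^-1.
have -> : g z = u *+ n by rewrite -mulr_natr divfK.
rewrite cexpMn.
have nu : cmod u <= M / n%:R.
  by rewrite cmodM cmodV cmod_nat ler_wpM2r ?invr_ge0 ?hM // ltW.
have h := cexp_quad (le_trans nu n1).
have B1 : 1 + M / n%:R <= expR (M / n%:R) := expR_ge1Dx _.
have Mn0 : 0 <= M / n%:R by rewrite divr_ge0 // ltW.
apply: (le_trans (@cmod_subX _ _ (expR (M / n%:R)) n _ _ _)).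
- by rewrite cmod_cexp ler_expR (le_trans _ nu) // (le_trans _ (Re_le_nm _)) // ler_norm.
- by rewrite (le_trans (cmodD _ _)) // cmod1; lra.
- by lra.
rewrite -expRM_natr divfK ?gt_eqF // -(ler_pM2r n0) (le_trans _ n2) //.
have -> : 3 * M ^+ 2 * expR M = n%:R * (3 * (M / n%:R) ^+ 2) * expR M * n%:R.
  by field; rewrite gt_eqF.
rewrite ler_pM2r // ler_pM2r ?expR_gt0 // ler_pM2l // opprD addrA (le_trans h) //.
by rewrite ler_pM2l // lerXn2r ?nnegrE ?cmod_ge0.
Qed.
End S5.

(** * The function B *)

Section S6.
Local Open Scope classical_set_scope.
Local Open Scope ring_scope.
Local Open Scope complex_scope.
Variable R : realType.
Local Notation C := R[i].
Local Notation Re := (@complex.Re R).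
Local Notation Im := (@complex.Im R).
Implicit Types (z w : C) (a b c : nat -> C).

Lemma sqrtc_Re_ge0 z : 0 <= Re (sqrtc z).
Proof. by case: z => x y; rewrite /sqrtc /= sqrtr_ge0. Qed.

Lemma sqrtc_uniq z w : w ^+ 2 = z -> 0 < Re w -> sqrtc z = w.
Proof.
move=> E w0; have := sqr_sqrtc z; rewrite -{2}E => /eqP.
rewrite eqf_sqr => /orP[/eqP //|/eqP h].
by exfalso; have := sqrtc_Re_ge0 z; rewrite h raddfN /=; lra.
Qed.

Lemma sqrtc_near1 z : cmod (z - 1) <= 7/10 ->
  cmod (sqrtc z - 1) <= 54/100 /\ 46/100 <= Re (sqrtc z).
Proof.
move=> h; have s0 := sqrtc_Re_ge0 z; set s := sqrtc z in s0 *.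
have E : z - 1 = (s - 1) * (s + 1) by rewrite -[z]sqr_sqrtc -/s; ring.
have A : Re s + 1 <= cmod (s + 1).
  by have := le_trans (ler_norm _) (Re_le_nm (s + 1)); rewrite raddfD.
have B : 1 - Re s <= cmod (s - 1).
  have := le_trans (ler_norm _) (Re_le_nm (1 - s)); rewrite cmodBC raddfB; exact.
move: h; rewrite E cmodM => h; have n0 := cmod_ge0 (s - 1).
have h1 : cmod (s - 1) * (Re s + 1) <= 7/10 by apply: le_trans h; rewrite ler_wpM2l.
(* From (1 - Re s)(1 + Re s) <= 7/10. This crude bound suffices, since (7/10) / (13/10) < 54/100. *)
have r3 : 3/10 <= Re s by nra.
have n54 : cmod (s - 1) <= 54/100 by nra.
by split=> //; lra.
Qed.

(** Newton's method for the inverse root uses products and sums only, with division by 2; the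
    iteration for the root itself would divide by the iterate and leave the operations known to
    preserve [papprox]. *)
Fixpoint newton_rsqrt (z : C) n : C :=
  if n is m.+1 then newton_rsqrt z m * (3 - z * newton_rsqrt z m ^+ 2) / 2 else 1.

(* The error d = 1 - y sqrt z satisfies d' = d^2 (3 - d) / 2 after one step. *)
Lemma newton_rsqrtP z n : cmod (z - 1) <= 7/10 ->
  cmod (1 - newton_rsqrt z n * sqrtc z) <= (24/25) ^+ n.
Proof.
move=> h; have [s1 _] := sqrtc_near1 h; set s := sqrtc z in s1 *.
(* The first bound is the invariant: it gives |3 - d| <= 354/100, hence a contraction factor |d| |3
   - d| / 2 <= 24/25, which preserves it. *)
suff : cmod (1 - newton_rsqrt z n * s) <= 54/100 /\
       cmod (1 - newton_rsqrt z n * s) <= (24/25) ^+ n by case.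
elim: n => [|n [IH1 IH2]] /=.
  by rewrite mul1r cmodBC expr0; split=> //; lra.
set y := newton_rsqrt z n in IH1 IH2 *; set d := 1 - y * s in IH1 IH2.
have -> : 1 - y * (3 - z * y ^+ 2) / 2 * s = d * (d * (3 - d) / 2).
  by rewrite -[z]sqr_sqrtc -/s /d; field.
have d3 : cmod (3 - d) <= 354/100.
  by rewrite (le_trans (cmodB _ _)) // cmod_nat; lra.
rewrite !cmodM cmodV cmod_nat.
have A : cmod d * cmod (3 - d) / 2 <= 24/25 by have := cmod_ge0 d; have := cmod_ge0 (3 - d); nra.
split; first by have := cmod_ge0 d; nra.
by rewrite exprSr ler_pM ?cmod_ge0 // divr_ge0 // mulr_ge0 ?cmod_ge0.
Qed.

Lemma papprox_rsqrt (g : C -> C) : papprox g ->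
  (forall z, cmod z < 1 -> cmod (g z - 1) <= 7/10) -> papprox (fun z => (sqrtc (g z))^-1).
Proof.
move=> hg g1; apply: papprox_lim => r r0 r1 e e0.
(* 1/s - y = (1 - y s)/s and |s| >= 46/100. *)
have [N hN] : exists N, forall n, (N <= n)%N -> (100/46) * (24/25) ^+ n <= e.
  by apply: geo_small => //; lra.
exists (fun z => newton_rsqrt (g z) N).
  elim: N {hN} => [|N IH] /=; first exact: papprox_cst.
  apply: papproxM; last exact: papprox_cst.
  apply: papproxM => //; apply: papproxD; first exact: papprox_cst.
  apply: (@papprox_eq _ (fun z => -1 * (g z * newton_rsqrt (g z) N ^+ 2))).
    by move=> z _; rewrite mulN1r.
  apply: papproxM; first exact: papprox_cst.
  by apply: papproxM => //; exact: papproxX.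
move=> z zr; have gz := g1 z (le_lt_trans zr r1).
have [_ s46] := sqrtc_near1 gz; have := newton_rsqrtP N gz.
set s := sqrtc (g z) in s46 *; set y := newton_rsqrt _ _ => h.
have ns : 46/100 <= cmod s by rewrite (le_trans s46) // (le_trans (ler_norm _)) // Re_le_nm.
have ns0 : 0 < cmod s by lra.
have s0 : s != 0 by apply: contraTneq ns0 => ->; rewrite cmod0 ltxx.
have -> : s^-1 - y = (1 - y * s) / s by field.
rewrite cmodM cmodV ler_pdivrMr // (le_trans h) //.
have := hN N (leqnn N); nra.
Qed.

(** * The hyperbolic cosine on the closed unit disk, and the resulting form of B *)

Definition ccosh (z : C) : C := (cexp z + cexp (- z)) / 2.

(* Both e^x (1 - x/8)^8 and e^-x (1 + x/8)^8 are at most 1. *)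
Lemma cosh_real_bound (x : R) : `|x| <= 1 -> expR x + expR (- x) <= 2 + 7/5 * x ^+ 2.
Proof.
rewrite ler_norml => /andP[x1 x2]; pose a := x / 8.
have aux (t : R) : -(1/8) <= t -> t <= 1/8 -> expR (8 * t) * (1 - t) ^+ 8 <= 1.
  move=> t1 t2; have -> : expR (8 * t) = expR t ^+ 8 by rewrite expRM_natl.
  rewrite -exprMn exprn_ile1 //; first by rewrite mulr_ge0 ?expR_ge0 //; lra.
  rewrite -[leRHS](expRxMexpNx_1 t) ler_wpM2l ?expR_ge0 //.
  by have := expR_ge1Dx (- t).
have xE : x = 8 * a by rewrite /a; field.
have A := aux a; have B := aux (- a); rewrite mulrN -xE opprK in A B.
have {}A : expR x * (1 - a) ^+ 8 <= 1 by apply: A; rewrite /a; lra.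
have {}B : expR (- x) * (1 + a) ^+ 8 <= 1 by apply: B; rewrite /a; lra.
pose b := a ^+ 2; have b0 : 0 <= b by apply: sqr_ge0.
have b1 : b <= 1/64 by rewrite /b /a; nra.
rewrite xE exprMn -/b -xE.
set E := expR x in A *; set F := expR (- x) in B *.
have E0 : 0 < E := expR_gt0 _; have F0 : 0 < F := expR_gt0 _.
have P1 : 0 <= (1 + a) ^+ 8 by apply: exprn_ge0; rewrite /a; lra.
have P2 : 0 <= (1 - a) ^+ 8 by apply: exprn_ge0; rewrite /a; lra.
(* As (1 - a)(1 + a) = 1 - b, multiplying the bounds on e^x and e^-x by (1 + a)^8 and (1 - a)^8
   gives both the same factor. *)
have S : (E + F) * (1 - b) ^+ 8 <= (1 + a) ^+ 8 + (1 - a) ^+ 8.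
  have -> : (E + F) * (1 - b) ^+ 8 = (E * (1 - a) ^+ 8) * (1 + a) ^+ 8 + (F * (1 + a) ^+
    8) * (1 - a) ^+ 8.
    by rewrite /b; ring.
  by rewrite lerD // ler_piMl.
have bern : 1 - 8 * b <= (1 - b) ^+ 8.
  have b2 : 1 - 2 * b <= (1 - b) ^+ 2 by nra.
  have b4 : 1 - 4 * b <= (1 - b) ^+ 4.
    have -> : (1 - b) ^+ 4 = ((1 - b) ^+ 2) ^+ 2 by ring.
    nra.
  have -> : (1 - b) ^+ 8 = ((1 - b) ^+ 4) ^+ 2 by ring.
  nra.
have S2 : (E + F) * (1 - 8 * b) <= 2 * (1 + 28 * b + 70 * b ^+ 2 + 28 * b ^+ 3 + b ^+ 4).
  rewrite (@le_trans _ _ ((1 + a) ^+ 8 + (1 - a) ^+ 8)) //; last first.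
    by apply: eq_ler; rewrite /b; ring.
  by rewrite (le_trans _ S) // ler_wpM2l // ltW // addr_gt0.
(* 448/10 is half of 64 * 7/5, because x^2 = 64 b. *)
have q : 1 + 28 * b + 70 * b ^+ 2 + 28 * b ^+ 3 + b ^+ 4 <= (1 + 448/10 * b) * (1 - 8 * b).
  have b2 : b ^+ 2 <= b / 64 by nra.
  have b3 : b ^+ 3 <= b / 64 by rewrite exprS; nra.
  have b4 : b ^+ 4 <= b / 64 by rewrite exprS; nra.
  nra.
have d : 0 < 1 - 8 * b by lra.
by rewrite -(ler_pM2r d) (le_trans S2) //; nra.
Qed.

(** cosh x - cos y <= (7/10) x^2 + y^2/2, and x^2 + y^2 <= 1. *)
Lemma ccosh_near1 z : cmod z <= 1 -> cmod (ccosh z - 1) <= 7/10.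
Proof.
move=> z1; have := sqr_cmod z; have := le_trans (Re_le_nm z) z1.
case: z z1 => x y z1 /= xb; move: z1; set r := cmod _ => z1 n2.
have r0 : 0 <= r by apply: cmod_ge0.
have C1 := cosh_real_bound xb; have C2 := cos_ge y; have C3 := cos_le1 y.
have D := expRxMexpNx_1 x; have E := expR_gt0 x; have F := expR_gt0 (- x).
have SC := cos2Dsin2 y.
pose A := (expR x + expR (- x)) / 2.
have A1 : 1 <= A by have := expR_ge1Dx x; have := expR_ge1Dx (- x); rewrite /A; lra.
(* |cosh (x + iy) - 1| = cosh x - cos y. *)
suff H : cmod (ccosh (x +i* y) - 1) ^+ 2 = (A - cos y) ^+ 2.
  have : cmod (ccosh (x +i* y) - 1) = A - cos y.
    by apply/eqP; rewrite -(eqrXn2 (n := 2)) ?cmod_ge0 ?subr_ge0 ?(le_trans C3) // H.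
  by move=> ->; rewrite /A; nra.
have -> : ccosh (x +i* y) = ((expR x +
  expR (- x)) * cos y / 2) +i* ((expR x - expR (- x)) * sin y / 2).
  have -> : ccosh (x +i* y) = (cexp (x +i* y) + cexp (- (x +i* y))) * (2^-1)%:C.
    by rewrite /ccosh fmorphV rmorph_nat.
  rewrite /cexp /= cosN sinN.
  by apply/eqP; rewrite eq_complex /=; apply/andP; split; apply/eqP; ring.
rewrite sqr_cmod /= oppr0 addr0 /A.
set e := expR x in D *; set f := expR (- x) in D *; set c := cos y in SC *; set s := sin y in SC *.
have -> : ((e - f) * s / 2) ^+ 2 = ((e + f) ^+ 2 / 4 - e * f) * s ^+ 2 by field.
have -> : s ^+ 2 = 1 - c ^+ 2 by rewrite -SC addrC addKr.
by rewrite D; field.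
Qed.

Lemma ccosh_neq0 z : cmod z <= 1 -> ccosh z != 0.
Proof.
move=> /ccosh_near1 h; apply/eqP => E; move: h.
by rewrite E sub0r cmodN cmod1; lra.
Qed.

(** The factor exp(z/2) turns by an angle y of at most 1/2, and the root u + iv has u >= 46/100 and
    |v| <= 54/100. So cos y * u + sin y * v is at least (7/8)(46/100) - 27/100 > 0. This sign
    selects the branch in [BfunE] and later yields univalence. *)
Lemma Re_halfexp_div z : cmod z <= 1 -> 0 < Re (cexp (z / 2) / sqrtc (ccosh z)).
Proof.
move=> z1; have [s1 s2] := sqrtc_near1 (ccosh_near1 z1).
set s := sqrtc _ in s1 s2 *.
have [y ye yb] : exists2 y : R, cexp (z / 2) = (expR (Re z / 2))%:C * (cos y +i* sin y) & `|y| <=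
  1/2.
  exists (Im z / 2); last first.
    rewrite normrM [X in _ * X]ger0_norm ?invr_ge0 //.
    by have := Im_le_nm z; lra.
  case: z {z1 s s1 s2} => x y.
  have -> : (x +i* y) / 2 = (x / 2) +i* (y / 2).
    rewrite -(rmorph_nat (@real_complex R)) -fmorphV.
    by apply/eqP; rewrite eq_complex /=; apply/andP; split; apply/eqP; ring.
  by apply/eqP; rewrite eq_complex /=; apply/andP; split; apply/eqP; ring.
have sb := sin_le y; have cb := cos_ge y.
have si : `|Im s| <= 54/100.
  by apply: le_trans s1; have := Im_le_nm (s - 1); rewrite raddfB /= subr0.
have s0 : 0 < Re s by lra.
have ns : 0 < (cmod s ^+ 2)^-1.
  by rewrite invr_gt0 sqr_cmod ltr_wpDr ?sqr_ge0 // exprn_gt0.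
have -> : cexp (z / 2) / s = ((expR (Re z / 2)) * (cmod s ^+ 2)^-1)%:C * ((cos y +i* sin y) * s^*).
  have sn : s != 0 by apply: contraTneq s0 => ->; rewrite /= ltxx.
  have nE : ((cmod s ^+ 2)^-1)%:C = (s * s^*)^-1 by rewrite mulrJ fmorphV.
  have mC (p q : R) : (p * q)%:C = p%:C * q%:C by exact: rmorphM.
  rewrite ye mC nE.
  have sn' : s^* != 0 by rewrite conjc_eq0.
  by field; apply/andP.
have -> (k : R) (w : C) : Re (k%:C * w) = k * Re w by case: w => u v /=; ring.
rewrite mulr_gt0 //; first by rewrite mulr_gt0 ?expR_gt0.
move: s0 s2 si; case: s {s1 ns} => u v /= u0 u46 vb.
have -> : cos y * u - sin y * - v = cos y * u + sin y * v by ring.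
have c8 : 7/8 <= cos y.
  have : y ^+ 2 <= 1/4 by rewrite -(real_normK (num_real y)); have := normr_ge0 y; nra.
  by lra.
have sv : `|sin y * v| <= 27/100.
  have := ler_pM (normr_ge0 _) (normr_ge0 _) (le_trans sb yb) vb.
  by rewrite normrM; lra.
by move: sv; rewrite ler_norml => /andP[sv _]; nra.
Qed.

(** Both sides square to e^z / cosh z = 1 + tanh z, and a root with positive real part is the
    principal one. *)
Lemma BfunE z : cmod z <= 1 -> Bfun z = cexp (z / 2) / sqrtc (ccosh z).
Proof.
move=> z1; apply: sqrtc_uniq; last exact: Re_halfexp_div.
rewrite exprMn exprVn sqr_sqrtc -cexpMn -[_ *+ 2]mulr_natr divfK ?pnatr_eq0 //.
have := ccosh_neq0 z1; rewrite /ccosh /ctanh mulf_eq0 invr_eq0 pnatr_eq0 orbF => h.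
by field; rewrite h.
Qed.

Lemma Re_Bfun_gt0 z : cmod z <= 1 -> 0 < Re (Bfun z).
Proof. by move=> z1; rewrite BfunE // Re_halfexp_div. Qed.

Lemma Bfun0 : Bfun 0 = 1 :> C.
Proof. by rewrite /Bfun /ctanh oppr0 subrr mul0r addr0 sqrtc1. Qed.

Lemma sqr_Bfun z : cmod z <= 1 -> Bfun z ^+ 2 * (1 + cexp (- (z *+ 2))) = 2.
Proof.
move=> z1; rewrite sqr_sqrtc /ctanh.
have := ccosh_neq0 z1; rewrite /ccosh mulf_eq0 invr_eq0 pnatr_eq0 orbF => h.
rewrite -mulNrn cexpMn.
have e0 := cexp_neq0 z; have E := cexpN z.
have -> : cexp (- z) = (cexp z)^-1 by rewrite -[RHS]mul1r -E; field.
have h' : cexp z + (cexp z)^-1 != 0.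
  by rewrite (_ : (cexp z)^-1 = cexp (- z)) // -[LHS]mul1r -E; field.
have h2 : cexp z ^+ 2 + 1 != 0.
  apply: contra h' => /eqP h2; have -> : cexp z + (cexp z)^-1 = (cexp z ^+ 2 + 1) / cexp z by field.
  by rewrite h2 mul0r.
by field; rewrite e0 h2.
Qed.

Lemma papprox_Bfun (g : C -> C) : papprox g -> (forall z, cmod z < 1 -> cmod (g z) <= 1) ->
  papprox (fun z => Bfun (g z)).
Proof.
move=> hg g1; apply: (@papprox_eq _ (fun z => cexp (g z / 2) * (sqrtc (ccosh (g z)))^-1)).
  by move=> z z1; rewrite BfunE // g1.
apply: papproxM.
  by apply: papprox_cexp; apply: papproxM => //; exact: papprox_cst.
apply: papprox_rsqrt; last by move=> z z1; rewrite ccosh_near1 // g1.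
apply: papproxM; last exact: papprox_cst.
apply: papproxD; apply: papprox_cexp => //.
apply: (@papprox_eq _ (fun z => -1 * g z)); first by move=> z _; rewrite mulN1r.
by apply: papproxM => //; exact: papprox_cst.
Qed.
End S6.

(** * Complex derivative and univalence *)

Section S7.
Local Open Scope classical_set_scope.
Local Open Scope ring_scope.
Local Open Scope complex_scope.
Variable R : realType.
Local Notation C := R[i].
Local Notation Re := (@complex.Re R).
Local Notation Im := (@complex.Im R).
Implicit Types (z w : C) (a b c : nat -> C).

(** Stated over a general field because it serves twice: over [R[i]] for the derivative of a power
    series, and over [R] for its restriction to a segment. *)
Lemma quad_is_derive (F : numFieldType) (V : normedModType F) (f : F -> V) x l (K d : F) :
  0 <= K -> 0 < d ->
  (forall h, `|h| < d -> `|f (h + x) - f x - h *: l| <= K * `|h| ^+ 2) ->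
  is_derive x 1 f l.
Proof.
move=> K0 d0 H.
suff C : h^-1 *: (f (h *: 1 + x) - f x) @[h --> 0^'] --> l.
  by apply: DeriveDef; [apply/cvg_ex; exists l|apply: cvg_lim => //; exact: norm_hausdorff].
apply/cvgrPdist_le => e e0.
have K1 : 0 < K + 1 by rewrite ltr_wpDl.
have m0 : 0 < e / (K + 1) by rewrite divr_gt0.
have A : \forall h \near (0 : F)^', `|h| < d.
  by apply: dnbhs0_lt.
have B : \forall h \near (0 : F)^', `|h| < e / (K + 1).
  by apply: dnbhs0_lt.
near=> h.
have h0 : h != 0 by near: h; exact: nbhs_dnbhs_neq.
have hd : `|h| < d by near: h.
have hm : `|h| < e / (K + 1) by near: h.
have -> : h *: (1 : F) = h by rewrite -[RHS]mulr1.
rewrite distrC -[X in _ - X](scalerK h0) -scalerBr normrZ normfV.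
have nh : 0 < `|h| by rewrite normr_gt0.
rewrite mulrC ler_pdivrMr // (le_trans (H h hd)) // expr2 mulrA ler_wpM2r //.
rewrite (@le_trans _ _ (K * (e / (K + 1)))) ?ler_wpM2l // ?ltW //.
rewrite mulrCA gtr_pMr // ltr_pdivrMr // mul1r ltrDl //.
Unshelve. all: by end_near. Qed.

Lemma sum_rad_ge1 a (r : R) : rad_ge1 a -> 0 <= r -> r < 1 ->
  exists2 K : R, 0 <= K & forall n, \sum_(k < n) cmod (a k) * r ^+ k <= K.
Proof.
move=> ga r0 r1; pose s := (r + 1) / 2.
have s0 : 0 < s by rewrite /s; lra.
have s1 : s < 1 by rewrite /s; lra.
have [K hK] := ga s s0 s1.
have K0 : 0 <= K by apply: le_trans (hK 0%N); rewrite mulr1 cmod_ge0.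
pose q := r / s.
have q0 : 0 <= q by rewrite divr_ge0 // ltW.
have q1 : q < 1 by rewrite ltr_pdivrMr // mul1r /s; lra.
exists (K * (1 / (1 - q))); first by rewrite mulr_ge0 // divr_ge0 // subr_ge0 ltW.
move=> n; rewrite (@le_trans _ _ (\sum_(k < n) K * q ^+ k)) //.
  apply: ler_sum => k _.
  have -> : r ^+ k = s ^+ k * q ^+ k by rewrite -exprMn /q mulrC divfK // gt_eqF.
  by rewrite mulrA ler_wpM2r ?exprn_ge0.
rewrite -big_distrr /= ler_wpM2l // -(big_mkord xpredT (fun k => q ^+ k)).
by have := geo_sum_le 0 n q0 q1; rewrite expr0.
Qed.

(** The factor r on the left avoids r^(k-1) on the right, and the generous constant (k+1)^2 closes
    the induction by (k+1)^2 + (k+1) <= (k+2)^2. *)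
Lemma expr_quad_le (z w : C) (r : R) k : cmod z <= r -> cmod w <= r ->
  cmod (w ^+ k.+1 - z ^+ k.+1 - (w - z) * (z ^+ k *+ k.+1)) * r <=
    (k.+1 ^ 2)%:R * r ^+ k * cmod (w - z) ^+ 2.
Proof.
move=> zr wr; have r0 : 0 <= r := le_trans (cmod_ge0 _) zr.
elim: k => [|k IH].
  by rewrite !expr1 mulr1n mulr1 subrr cmod0 mul0r mulr_ge0 ?sqr_ge0 // mulr_ge0 // exprn_ge0.
have -> : w ^+ k.+2 - z ^+ k.+2 - (w - z) * (z ^+ k.+1 *+ k.+2) =
  w * (w ^+ k.+1 - z ^+ k.+1 - (w - z) * (z ^+ k *+ k.+1)) + (w - z) ^+ 2 * (z ^+ k *+ k.+1).
  by rewrite -[z ^+ k *+ _]mulr_natr -[z ^+ k.+1 *+ _]mulr_natr -(natr1 k.+1) !exprS; ring.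
rewrite (le_trans (ler_wpM2r r0 (cmodD _ _))) // mulrDl [cmod (w * _)]cmodM [cmod (_ ^+
  2 * _)]cmodM cmodX.
rewrite -[X in cmod (X *+ k.+1)]mulr1 -mulrnAr cmodM cmodX cmod_nat.
set D := cmod (_ - (w - z) * _) in IH *; set t := cmod (w - z) in IH *.
have h1 : cmod w * D * r <= r * ((k.+1 ^ 2)%:R * r ^+ k * t ^+ 2).
  by rewrite -mulrA ler_pM ?cmod_ge0 // mulr_ge0 ?cmod_ge0.
have h2 : t ^+ 2 * (cmod z ^+ k * k.+1%:R) * r <= t ^+ 2 * (r ^+ k * k.+1%:R) * r.
  rewrite ler_wpM2r // ler_wpM2l ?sqr_ge0 // ler_wpM2r //.
  by rewrite lerXn2r ?nnegrE ?cmod_ge0.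
rewrite (le_trans (lerD h1 h2)) //.
have -> : r * ((k.+1 ^ 2)%:R * r ^+ k * t ^+ 2) + t ^+ 2 * (r ^+ k * k.+1%:R) * r =
  (k.+1 ^ 2 + k.+1)%:R * (r ^+ k.+1 * t ^+ 2).
  by rewrite natrD (exprS r); move: (k.+1 ^ 2)%:R k.+1%:R => A B; ring.
rewrite -mulrA ler_wpM2r ?mulr_ge0 ?exprn_ge0 ?sqr_ge0 ?cmod_ge0 // ler_nat.
by rewrite -mulnn addnC -mulnS -[(k.+2 ^ 2)%N]mulnn leq_mul.
Qed.

Lemma cmod_remainder_approx (pw pz dz fw fz dfz v : C) (e : R) : cmod v <= 2 ->
  cmod (pw - fw) <= e -> cmod (pz - fz) <= e -> cmod (dz - dfz) <= e ->
  cmod (fw - fz - v * dfz) <= cmod (pw - pz - v * dz) + 4 * e.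
Proof.
move=> v2 hw hz hd.
have -> : fw - fz - v * dfz = (pw - pz - v * dz) + ((pz - fz) - (pw - fw) + v * (dz - dfz)) by ring.
rewrite (le_trans (cmodD _ _)) // lerD2l (le_trans (cmodD _ _)) // cmodM.
have := ler_pM (cmod_ge0 v) (cmod_ge0 _) v2 hd; have := cmodB (pz - fz) (pw - fw).
by move: hw hz; lra.
Qed.

Lemma pser_quad a (r : R) : rad_ge1 a -> 0 < r -> r < 1 ->
  exists2 K : R, 0 <= K & forall z w, cmod z <= r -> cmod w <= r ->
  cmod (pser a w - pser a z - (w - z) * pser (dcoef a) z) <= K * cmod (w - z) ^+ 2.
Proof.
move=> ga r0 r1.
(* With d = [dcoef a], the weights are (k+1)^2 |a_(k+1)| = k |d_k| + |d_k|; [K] and [L] bound the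
   two sums. *)
have [K K0 hK] := sum_rad_ge1 (rad_ge1_mulrn (rad_ge1_dcoef ga)) (ltW r0) r1.
have [L L0 hL] := sum_rad_ge1 (rad_ge1_dcoef ga) (ltW r0) r1.
exists ((K + L) / r); first by rewrite divr_ge0 ?addr_ge0 // ltW.
move=> z w zr wr; rewrite mulrAC ler_pdivlMr //.
(* A bound uniform in n passes to the limit; the lengths n + 1 and n match because the derivative of
   the first polynomial is the second. *)
suff P n : cmod ((psum a n.+1).[w] - (psum a n.+1).[z] - (w - z) * (psum (dcoef a) n).[z]) * r
    <= (K + L) * cmod (w - z) ^+ 2.
  have wz : cmod (w - z) <= 2.
    by rewrite (le_trans (cmodB _ _)) // -[2]/(1 + 1) lerD // ltW //
      ?(le_lt_trans wr) ?(le_lt_trans zr).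
  apply/ler_addgt0Pr => e e0; have e4 : 0 < e / 4 by rewrite divr_gt0.
  have [N1 h1] := pser_cvg ga (le_lt_trans wr r1) e4.
  have [N2 h2] := pser_cvg ga (le_lt_trans zr r1) e4.
  have [N3 h3] := pser_cvg (rad_ge1_dcoef ga) (le_lt_trans zr r1) e4.
  pose n := maxn N1 (maxn N2 N3).
  have n1 : (N1 <= n.+1)%N by rewrite leqW // leq_max leqnn.
  have n2 : (N2 <= n.+1)%N by rewrite leqW // !leq_max leqnn orbT.
  have n3 : (N3 <= n)%N by rewrite !leq_max leqnn !orbT.
  have := cmod_remainder_approx wz (h1 _ n1) (h2 _ n2) (h3 _ n3).
  rewrite [4 * _]mulrC divfK ?pnatr_eq0 // => Q.
  rewrite (le_trans (ler_wpM2r (ltW r0) Q)) // mulrDl lerD //.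
  by rewrite ler_piMr // ltW.
rewrite !horner_poly !big_ord_recl !expr0 opprD addrACA subrr add0r /= -sumrB big_distrr /= -sumrB.
rewrite (le_trans (ler_wpM2r (ltW r0) (cmod_sum _ _ _))) // big_distrl /=.
apply: (@le_trans _ _ (\sum_(k < n) (cmod (dcoef a k *+ k) * r ^+ k + cmod (dcoef a k) * r ^+
  k) * cmod (w - z) ^+ 2)); last first.
  rewrite -big_distrl /=; apply: ler_wpM2r; first exact: sqr_ge0.
  by rewrite big_split lerD ?hK ?hL.
apply: ler_sum => k _; rewrite /bump /= add1n /dcoef.
have -> : a k.+1 * w ^+ k.+1 - a k.+1 * z ^+ k.+1 - (w - z) * (a k.+1 *+ k.+1 * z ^+ k) =
  a k.+1 * (w ^+ k.+1 - z ^+ k.+1 - (w - z) * (z ^+ k *+ k.+1)).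
  by rewrite -[a k.+1 *+ _]mulr_natr -[z ^+ k *+ _]mulr_natr; ring.
rewrite cmodM -mulrA (le_trans (ler_wpM2l (cmod_ge0 _) (expr_quad_le k zr wr))) //.
rewrite -[_ *+ k.+1 *+ k]mulr_natr -[a k.+1 *+ _]mulr_natr !cmodM !cmod_nat.
by apply: eq_ler; rewrite -mulnn natrM -natr1; ring.
Qed.

Lemma is_derive_pser a z : rad_ge1 a -> cmod z < 1 -> is_derive z 1 (pser a) (pser (dcoef a) z).
Proof.
move=> ga z1; pose r := (1 + cmod z) / 2; have z0 := cmod_ge0 z.
have r0 : 0 < r by rewrite /r; lra.
have r1 : r < 1 by rewrite /r; lra.
have [K K0 h] := pser_quad ga r0 r1.
apply: (@quad_is_derive _ _ _ _ _ K%:C ((1 - cmod z) / 2)%:C).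
- by rewrite -[0]/(0%:C) lecR.
- by rewrite -[0]/(0%:C) ltcR; lra.
move=> k; rewrite normE ltcR => kd; rewrite normE -rmorphXn -rmorphM lecR.
have {2 3}-> : k = (k + z) - z by rewrite addrK.
apply: h; first by rewrite /r; lra.
by rewrite (le_trans (cmodD _ _)) // /r; lra.
Qed.

Lemma derive1_pser a z : rad_ge1 a -> cmod z < 1 -> derive1 (pser a) z = pser (dcoef a) z.
Proof. by move=> ga z1; rewrite derive1E; have [_ ->] := is_derive_pser ga z1. Qed.

(* Noshiro--Warschawski: along the segment from z to w, the real part of
   (w - z)^* f has derivative |w - z|^2 Re f' > 0. *)
Lemma pser_inj a : rad_ge1 a -> (forall z, cmod z < 1 -> 0 < Re (pser (dcoef a) z)) ->
  forall z w, cmod z < 1 -> cmod w < 1 -> pser a z = pser a w -> z = w.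
Proof.
move=> ga pos z w z1 w1; have [//|zw fzw] := eqVneq z w; exfalso; move: fzw.
have [v vE] : exists v, v = w - z by exists (w - z).
have v0 : 0 < cmod v by rewrite vE cmod_gt0 // subr_eq0 eq_sym.
have v2 : cmod v < 2 by rewrite vE (le_lt_trans (cmodB _ _)) //; lra.
pose u (t : R) := z + t%:C * v.
pose phi (t : R) : R := Re (v^* * pser a (u t)).
pose dphi (t : R) : R := cmod v ^+ 2 * Re (pser (dcoef a) (u t)).
have ReE (X : C) (h : R) : Re (v^* * (h%:C * v * X)) = h * (cmod v ^+ 2 * Re X).
  have -> : v^* * (h%:C * v * X) = h%:C * ((v * v^*) * X) by ring.
  by rewrite mulrJ; case: X => x y /=; ring.
have inu (t : R) : 0 <= t -> t <= 1 -> cmod (u t) < 1.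
  move=> t0 t1; have -> : u t = (1 - t)%:C * z + t%:C * w by rewrite /u vE rmorphB rmorph1; ring.
  rewrite (le_lt_trans (cmodD _ _)) // !cmodM !cmodr !ger0_norm ?subr_ge0 //.
  have := cmod_ge0 z; have := cmod_ge0 w; have [->|t1'] := eqVneq t 1; first by lra.
  by have : t < 1 by [rewrite lt_neqAle t1']; nra.
have dphiP (t : R) : 0 <= t -> t <= 1 -> is_derive t 1 phi (dphi t).
  move=> t0 t1; have ut := inu t t0 t1; pose r := (1 + cmod (u t)) / 2.
  have n0 := cmod_ge0 (u t).
  have r0 : 0 < r by rewrite /r; lra.
  have r1 : r < 1 by rewrite /r; lra.
  have [K K0 hK] := pser_quad ga r0 r1.
  apply: (@quad_is_derive _ _ _ _ _ (K * cmod v ^+ 3) ((1 - cmod (u t)) / 4)).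
  - by rewrite mulr_ge0 // exprn_ge0 // ltW.
  - by rewrite divr_gt0 // subr_gt0.
  move=> h hd.
  have uh : u (h + t) = u t + h%:C * v by rewrite /u rmorphD; ring.
  have nh : cmod (h%:C * v) = `|h| * cmod v by rewrite cmodM cmodr.
  have ur : cmod (u (h + t)) <= r.
    rewrite uh (le_trans (cmodD _ _)) // nh /r; have := normr_ge0 h; nra.
  have := hK (u t) (u (h + t)) ltac:(by rewrite /r; lra) ur.
  have -> : u (h + t) - u t = h%:C * v by rewrite uh addrAC subrr add0r.
  rewrite nh => Q.
  have -> : phi (h + t) - phi t - h *: dphi t =
    Re (v^* * (pser a (u (h + t)) - pser a (u t) - h%:C * v * pser (dcoef a) (u t))).
    rewrite -[h *: _]/(h * (cmod v ^+ 2 * Re (pser (dcoef a) (u t)))) -ReE.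
    by rewrite -[LHS]/(Re _ - Re _ - Re _) -!raddfB -!mulrBr.
  rewrite (le_trans (Re_le_nm _)) // cmodM cmod_conj.
  rewrite (le_trans (ler_wpM2l (ltW v0) Q)) //.
  by apply: eq_ler; ring.
have C : {within `[0, 1], continuous phi}.
  apply: derivable_within_continuous => t; rewrite in_itv /= => /andP[t0 t1].
  by have [] := dphiP t t0 t1.
have D (t : R) : t \in `]0, 1[%R -> is_derive t 1 phi (dphi t).
  by rewrite in_itv /= => /andP[t0 t1]; apply: dphiP; exact: ltW.
have [c] := MVT ltr01 D C; rewrite in_itv /= => /andP[c0 c1] + fzw.
have u1 : u 1 = w by rewrite /u mul1r vE addrC subrK.
have u0 : u 0 = z by rewrite /u mul0r addr0.
have -> : phi 1 = phi 0 by rewrite /phi u0 u1 fzw.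
rewrite {fzw} !subr0 subrr mulr1 => /esym/eqP; rewrite gt_eqF // mulr_gt0 ?exprn_gt0 //.
by apply: pos; apply: inu; exact: ltW.
Qed.
End S7.

(** * Second-order jets at 0 *)

Section S8.
Local Open Scope classical_set_scope.
Local Open Scope ring_scope.
Local Open Scope complex_scope.
Variable R : realType.
Local Notation C := R[i].
Local Notation Re := (@complex.Re R).
Local Notation Im := (@complex.Im R).
Implicit Types (z w : C) (a b c : nat -> C).

Implicit Types (f g phi : C -> C) (p q : C).

Definition near0 (P : C -> Prop) := exists2 d : R, 0 < d & forall z, cmod z <= d -> P z.

Lemma near0_and (P Q : C -> Prop) : near0 P -> near0 Q -> near0 (fun z => P z /\ Q z).
Proof.
move=> [d d0 hP] [e e0 hQ]; exists (Num.min d e); first by rewrite lt_min d0.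
by move=> z; rewrite le_min => /andP[/hP ? /hQ ?].
Qed.

Lemma near0_sub (P Q : C -> Prop) : (forall z, P z -> Q z) -> near0 P -> near0 Q.
Proof. by move=> PQ [d d0 hP]; exists d => // z /hP /PQ. Qed.

Lemma near0_disk (P : C -> Prop) : (forall z, cmod z < 1 -> P z) -> near0 P.
Proof. by move=> h; exists (1/2) => [|z zd]; [lra|apply: h; lra]. Qed.

Definition bnd phi := exists M, near0 (fun z => cmod (phi z) <= M).

Lemma bnd_cst p : bnd (fun=> p).
Proof. by exists (cmod p), 1. Qed.

Lemma bnd_id : bnd id.
Proof. by exists 1, 1. Qed.

Lemma bndD f g : bnd f -> bnd g -> bnd (fun z => f z + g z).
Proof.
move=> [M hM] [N hN]; exists (M + N); apply: near0_sub (near0_and hM hN) => z [h1 h2].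
by rewrite (le_trans (cmodD _ _)) // lerD.
Qed.

Lemma bndM f g : bnd f -> bnd g -> bnd (fun z => f z * g z).
Proof.
move=> [M hM] [N hN]; exists (M * N); apply: near0_sub (near0_and hM hN) => z [h1 h2].
by rewrite cmodM ler_pM ?cmod_ge0.
Qed.

Lemma bndX f n : bnd f -> bnd (fun z => f z ^+ n).
Proof.
move=> [M hM]; exists (M ^+ n); apply: near0_sub hM => z h.
by rewrite cmodX lerXn2r ?nnegrE ?cmod_ge0 // (le_trans (cmod_ge0 _) h).
Qed.

Lemma near0_small (K : R) (d : R) : 0 < d -> near0 (fun z => K * cmod z <= d).
Proof.
move=> d0; have k0 := normr_ge0 K; exists (d / (`|K| + 1)); first by rewrite divr_gt0 ?ltr_wpDl.
move=> z; rewrite ler_pdivlMr ?ltr_wpDl // => h.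
have := ler_norm K; have := cmod_ge0 z; nra.
Qed.

Lemma lin_near0_eq0 p (K : R) : near0 (fun z => cmod (p * z) <= K * cmod z ^+ 2) -> p = 0.
Proof.
move=> h; apply: cmod_eq0; apply: le_anti; rewrite cmod_ge0 andbT.
apply/ler_addgt0Pr => e e0; rewrite add0r.
have [d d0 hd] := near0_and h (near0_small K e0).
have [] := hd d%:C; first by rewrite cmodr gtr0_norm.
rewrite cmodM cmodr (gtr0_norm d0) expr2 mulrA ler_pM2r // => h1 h2.
exact: le_trans h2.
Qed.

(** A Taylor expansion that presupposes neither series nor derivatives. It is unique and
    multiplicative, so that functional equations can be compared degree by degree. *)
Definition jet f p0 p1 p2 := exists2 phi, bnd phi &
  near0 (fun z => f z = p0 + p1 * z + p2 * z ^+ 2 + z ^+ 3 * phi z).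

Lemma jet_eq f g p0 p1 p2 : near0 (fun z => f z = g z) -> jet f p0 p1 p2 -> jet g p0 p1 p2.
Proof.
move=> fg [phi hphi hf]; exists phi => //.
by apply: near0_sub (near0_and fg hf) => z [<-].
Qed.

Lemma jet_eq0 p0 p1 p2 : jet (fun=> 0) p0 p1 p2 -> [/\ p0 = 0, p1 = 0 & p2 = 0].
Proof.
move=> [phi [M hM] hf].
have p00 : p0 = 0.
  have [d d0 /(_ 0)] := hf; rewrite cmod0 => /(_ (ltW d0)).
  by rewrite mulr0 expr0n /= mulr0 !addr0 expr0n mul0r addr0.
(* Cancelling z^k leaves q z = - z^2 psi(z), of quadratic size, which forces q = 0; used for k = 0
   and k = 1. *)
have lin k q (psi : C -> C) : bnd psi ->
    near0 (fun z => 0 = q * z ^+ k.+1 + z ^+ k.+2 * psi z) -> q = 0.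
  move=> [N hN] hq; apply: (@lin_near0_eq0 _ N).
  apply: near0_sub (near0_and hN hq) => z [h1 h2].
  have [->|z0] := eqVneq z 0; first by rewrite mulr0 cmod0 expr0n mulr0.
  have -> : q * z = - (z ^+ 2 * psi z).
    apply/eqP; rewrite -addr_eq0; apply/eqP; apply: (mulfI (expf_neq0 k z0)).
    by rewrite mulr0 h2 !exprS; ring.
  by rewrite cmodN cmodM cmodX mulrC ler_wpM2r ?sqr_ge0.
have bphi : bnd phi by exists M.
have p10 : p1 = 0.
  apply: (lin 0%N _ (fun z => p2 + z * phi z)).
    by apply: bndD; [exact: bnd_cst|apply: bndM => //; exact: bnd_id].
  by apply: near0_sub hf => z ->; rewrite p00; ring.
split=> //; apply: (lin 1%N _ phi) => //.
by apply: near0_sub hf => z ->; rewrite p00 p10; ring.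
Qed.

Lemma jetD f g p0 p1 p2 q0 q1 q2 : jet f p0 p1 p2 -> jet g q0 q1 q2 ->
  jet (fun z => f z + g z) (p0 + q0) (p1 + q1) (p2 + q2).
Proof.
move=> [phi bf hf] [psi bg hg]; exists (fun z => phi z + psi z); first exact: bndD.
by apply: near0_sub (near0_and hf hg) => z [-> ->]; ring.
Qed.

Lemma jetM f g p0 p1 p2 q0 q1 q2 : jet f p0 p1 p2 -> jet g q0 q1 q2 ->
  jet (fun z => f z * g z) (p0 * q0) (p0 * q1 + p1 * q0) (p0 * q2 + p1 * q1 + p2 * q0).
Proof.
move=> [phi bf hf] [psi bg hg].
exists (fun z => (p1 * q2 + p2 * q1 + p2 * q2 * z) +
   (phi z * (q0 + q1 * z + q2 * z ^+ 2) + psi z * (p0 + p1 * z + p2 * z ^+ 2) + z ^+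
     3 * (phi z * psi z))).
  have bq (a0 a1 a2 : C) : bnd (fun z => a0 + a1 * z + a2 * z ^+ 2).
    apply: bndD; last by apply: bndM; [exact: bnd_cst|apply: bndX; exact: bnd_id].
    by apply: bndD; [exact: bnd_cst|apply: bndM; [exact: bnd_cst|exact: bnd_id]].
  apply: bndD.
    by apply: bndD; [exact: bnd_cst|apply: bndM; [exact: bnd_cst|exact: bnd_id]].
  apply: bndD; last by apply: bndM; [apply: bndX; exact: bnd_id|exact: bndM].
  by apply: bndD; apply: bndM.
by apply: near0_sub (near0_and hf hg) => z [-> ->]; ring.
Qed.

Lemma jet_cst p : jet (fun=> p) p 0 0.
Proof.
exists (fun=> 0); first exact: bnd_cst.
by exists 1 => // z _; ring.
Qed.

Lemma jet_uniq f p0 p1 p2 q0 q1 q2 : jet f p0 p1 p2 -> jet f q0 q1 q2 ->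
  [/\ p0 = q0, p1 = q1 & p2 = q2].
Proof.
move=> hp hq; have := jetD hp (jetM (jet_cst (-1)) hq).
move/(jet_eq (g := fun=> 0)) => H.
have [|A B D] := jet_eq0 (H _).
  by exists 1 => // z _; rewrite mulN1r subrr.
split; apply/eqP; rewrite -subr_eq0; apply/eqP.
- by rewrite -A; ring.
- by rewrite -B; ring.
- by rewrite -D; ring.
Qed.

Lemma jet_scale f p0 p1 p2 : jet f p0 p1 p2 -> jet (fun z => f (z *+ 2)) p0 (2 * p1) (4 * p2).
Proof.
have half (P : C -> Prop) : near0 P -> near0 (fun z => P (z *+ 2)).
  move=> [d d0 h]; exists (d / 2); first by rewrite divr_gt0.
  by move=> z zd; apply: h; rewrite -mulr_natr cmodM cmod_nat; lra.
move=> [phi [M hM] hf]; exists (fun z => 8 * phi (z *+ 2)).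
  by apply: bndM; [exact: bnd_cst|exists M; exact: (half (fun z => cmod (phi z) <= M))].
by apply: near0_sub (half _ hf) => z ->; rewrite -[z *+ 2]mulr_natr; ring.
Qed.

Lemma pser_shift a z : rad_ge1 a -> cmod z < 1 ->
  pser a z = a 0%N + z * pser (fun k => a k.+1) z.
Proof.
move=> ga z1; apply: pser_uniq => e e0.
have [N hN] := pser_cvg (rad_ge1_shift ga) z1 e0.
exists N.+1 => -[//|n] Nn; rewrite horner_poly big_ord_recl expr0 mulr1.
rewrite opprD addrACA subrr add0r.
have -> : \sum_(i < n) a (lift ord0 i) * z ^+ lift ord0 i = z * (psum (fun k => a k.+1) n).[z].
  rewrite horner_poly big_distrr; apply: eq_bigr => i _.
  by rewrite lift0 exprS /=; ring.
rewrite -mulrBr cmodM (le_trans _ (hN n Nn)) // ler_piMl ?cmod_ge0 // ltW //.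
Qed.

Lemma jet_pser a : rad_ge1 a -> jet (pser a) (a 0%N) (a 1%N) (a 2%N).
Proof.
move=> ga; have g1 := rad_ge1_shift ga; have g2 := rad_ge1_shift g1; have g3 := rad_ge1_shift g2.
exists (pser (fun k => a k.+3)).
  have [M _ hM] := @papprox_bounded _ _ (1/2) (papprox_pser g3) ltac:(lra) ltac:(lra).
  by exists M, (1/2) => //; lra.
apply: near0_disk => z z1.
rewrite (pser_shift ga z1) (pser_shift g1 z1) (pser_shift g2 z1); ring.
Qed.

Lemma pser0 a : rad_ge1 a -> pser a 0 = a 0%N.
Proof. by move=> ga; rewrite (pser_shift ga) ?mul0r ?addr0 // cmod0. Qed.

(** [weierstrass] supplies some power series, whose coefficients remain to be found. The quadratic
    bound [cexp_quad] determines the first one but is too coarse for the second. *)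
Lemma jet_cexp_id : jet (@cexp R) 1 1 (1 / 2).
Proof.
have : papprox (fun z : C => cexp z).
  apply: papprox_cexp; apply: papprox_eq (papprox_poly 'X) => z _; by rewrite hornerX.
move=> /weierstrass [e [ge he]].
have J : jet (@cexp R) (e 0%N) (e 1%N) (e 2%N).
  by apply: jet_eq (jet_pser ge); apply: near0_disk.
have e0 : e 0%N = 1 by rewrite -pser0 // he ?cmod0 // cexp0.
have e1 : e 1%N = 1.
  apply/eqP; rewrite -subr_eq0; apply/eqP.
  have [phi [M hM] hc] := J.
  have [N hN] : bnd (fun z => e 2%N + z * phi z).
    by apply: bndD; [exact: bnd_cst|apply: bndM; [exact: bnd_id|exists M]].
  apply: (@lin_near0_eq0 _ (3 + N)).
  have hq : near0 (fun z => cmod (cexp z - 1 - z) <= 3 * cmod z ^+ 2).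
    by exists (1/2) => [|z]; [lra|exact: cexp_quad].
  apply: near0_sub (near0_and hN (near0_and hc hq)) => z [h1 [h2 h3]].
  have -> : (e 1%N - 1) * z = (cexp z - 1 - z) - z ^+ 2 * (e 2%N + z * phi z).
    by rewrite h2 e0; ring.
  rewrite (le_trans (cmodB _ _)) // mulrDl lerD // cmodM cmodX mulrC ler_wpM2r ?sqr_ge0 //.
rewrite e0 e1 in J; have J2 := jet_scale J.
(* The second coefficient is forced by exp (2z) = (exp z)^2. *)
have Jsq : jet (fun z => cexp z * cexp z) 1 (2 * 1) (4 * e 2%N).
  by apply: jet_eq J2; exists 1 => // z _; rewrite cexpMn expr2.
have [_ _ h] := jet_uniq (jetM J J) Jsq.
suff <- : e 2%N = 1 / 2 by [].
apply/eqP; rewrite -subr_eq0; apply/eqP; apply: (mulfI (x := 2)); first by rewrite pnatr_eq0.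
transitivity (4 * e 2%N - (1 * e 2%N + 1 * 1 + e 2%N * 1)); first by field.
by rewrite h subrr mulr0.
Qed.

(** Write g = z U with U bounded. In exp g = 1 + g + g^2/2 + g^3 E(g) the last term is z^3 U^3 E(g),
    and E(g) is bounded near 0 because g tends to 0. *)
Lemma jet_cexp g p1 p2 : jet g 0 p1 p2 ->
  jet (fun z => cexp (g z)) 1 p1 (p2 + p1 ^+ 2 / 2).
Proof.
move=> J; have [phi bphi hg] := J; have [E [M [d d0 hE]] [d' d'0 hc]] := jet_cexp_id.
pose U z := p1 + p2 * z + z ^+ 2 * phi z.
have bU : bnd U.
  apply: bndD; last by apply: bndM => //; apply: bndX; exact: bnd_id.
  by apply: bndD; [exact: bnd_cst|apply: bndM; [exact: bnd_cst|exact: bnd_id]].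
have gU : near0 (fun z => g z = z * U z).
  by apply: near0_sub hg => z ->; rewrite /U; ring.
have small e : 0 < e -> near0 (fun z => cmod (g z) <= e).
  move=> e0; have [N hN] := bU.
  apply: near0_sub (near0_and gU (near0_and hN (near0_small N e0))) => z [-> [h1 h2]].
  by rewrite cmodM (le_trans _ h2) // mulrC ler_wpM2r ?cmod_ge0.
have J1 : jet (fun z => 1 + 1 * g z + (1/2) * (g z * g z)) 1 p1 (p2 + p1 ^+ 2 / 2).
  have := jetD (jetD (jet_cst 1) (jetM (jet_cst 1) J)) (jetM (jet_cst (1/2)) (jetM J J)).
  set a0 := (X in jet _ X _ _); set a1 := (X in jet _ _ X _); set a2 := (X in jet _ _ _ X).
  have -> : a0 = 1 by rewrite /a0; ring.
  have -> : a1 = p1 by rewrite /a1; ring.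
  by have -> : a2 = p2 + p1 ^+ 2 / 2 by rewrite /a2; field.
have J2 : jet (fun z => z ^+ 3 * (U z ^+ 3 * E (g z))) 0 0 0.
  exists (fun z => U z ^+ 3 * E (g z)); last by exists 1 => // z _; ring.
  apply: bndM; first exact: bndX.
  by exists M; apply: near0_sub (small d d0) => z; exact: hE.
have := jetD J1 J2; rewrite !addr0; apply: jet_eq.
apply: near0_sub (near0_and gU (small d' d'0)) => z [h1 h2].
by rewrite (hc _ h2) h1; ring.
Qed.

Lemma coef_of_Bfun b c : rad_ge1 b -> rad_ge1 c -> c 0%N = 0 ->
  (forall z, cmod z < 1 -> cmod (pser c z) < 1) ->
  (forall z, cmod z < 1 -> pser b z = Bfun (pser c z)) ->
  [/\ b 0%N = 1, b 1%N = c 1%N / 2 & b 2%N = c 2%N / 2 - c 1%N ^+ 2 / 8].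
Proof.
move=> gb gc c0 c1 hb.
have b0 : b 0%N = 1 by rewrite -pser0 // hb ?cmod0 // pser0 // c0 Bfun0.
have Jb := jet_pser gb; have Jc := jet_pser gc; rewrite b0 c0 in Jb Jc.
have Jm : jet (fun z => -2 * pser c z) 0 (-2 * c 1%N) (-2 * c 2%N).
  by have := jetM (jet_cst (-2)) Jc; rewrite !mulr0 !mul0r !addr0.
have J := jetM (jetM Jb Jb) (jetD (jet_cst 1) (jet_cexp Jm)).
have n2 : near0 (fun z => pser b z * pser b z * (1 + cexp (-2 * pser c z)) = 2).
  apply: near0_disk => z z1; rewrite hb // -expr2.
  rewrite -[RHS](sqr_Bfun (ltW (c1 z z1))); congr (_ * (1 + cexp _)).
  by rewrite -mulr_natr; ring.
(* [A] reads 4 b_1 - 2 c_1 = 0, and [B] is affine in b_2 with leading coefficient 4; hence the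
   factor 4 in both cancellations. *)
have [_ A B] := jet_uniq (jet_eq n2 J) (jet_cst 2).
have b1 : b 1%N = c 1%N / 2.
  apply/eqP; rewrite -subr_eq0; apply/eqP; apply: (mulfI (x := 4)).
    by rewrite pnatr_eq0.
  by rewrite mulr0 -[RHS]A; field.
split=> //; apply/eqP; rewrite -subr_eq0; apply/eqP; apply: (mulfI (x := 4)).
  by rewrite pnatr_eq0.
by rewrite mulr0 -[RHS]B b1; field.
Qed.
End S8.

(** * The class BT *)

Section S9.
Local Open Scope classical_set_scope.
Local Open Scope ring_scope.
Local Open Scope complex_scope.
Variable R : realType.
Local Notation C := R[i].
Local Notation Re := (@complex.Re R).
Local Notation Im := (@complex.Im R).
Implicit Types (z w : C) (a b c : nat -> C).

Lemma Gamma_of_subord a c : rad_ge1 a -> rad_ge1 c -> c 0%N = 0 ->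
  (forall z, cmod z < 1 -> cmod (pser c z) < 1) ->
  (forall z, cmod z < 1 -> derive1 (pser a) z = Bfun (pser c z)) ->
  Gamma1 a = - (c 1%N / 8) /\ Gamma2 a = 13 / 192 * c 1%N ^+ 2 - c 2%N / 12.
Proof.
move=> ga gc c0 c1 da.
have hb z : cmod z < 1 -> pser (dcoef a) z = Bfun (pser c z).
  by move=> z1; rewrite -derive1_pser // da.
have [_ b1 b2] := coef_of_Bfun (rad_ge1_dcoef ga) gc c0 c1 hb.
have dK k : a k.+1 = dcoef a k / k.+1%:R.
  by rewrite /dcoef -[a k.+1 *+ _]mulr_natr mulfK // pnatr_eq0.
by rewrite /Gamma1 /Gamma2 !dK b1 b2; split; field.
Qed.

(** Inserting y <= 1 - x^2 gives g2 >= (29 x^2 - 16)/192, where 29 = 13 + 16. Up to the zero x =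
    4/sqrt 29 the bound g2 >= 0 suffices; beyond it this quadratic grows at least as fast as x/8.
    Hence the minimum is -x/8 at that zero. *)
Lemma Gamma_diff_bounds (x y g1 g2 : R) : 0 <= x -> 0 <= g2 -> y <= 1 - x ^+ 2 -> g1 = x / 8 ->
  13 / 192 * x ^+ 2 - y / 12 <= g2 -> g2 <= 13 / 192 * x ^+ 2 + y / 12 ->
  - (1 / (2 * Num.sqrt 29)) <= g2 - g1 /\ g2 - g1 <= 1 / 12.
Proof.
move=> x0 g0 yx -> h1 h2; split; last by nra.
set s := Num.sqrt 29; have s2 : s ^+ 2 = 29 by rewrite sqr_sqrtr.
have s0 : 0 < s by rewrite sqrtr_gt0.
have s3 : 3 <= s by nra.
have -> : 1 / (2 * s) = s^-1 / 2 by field; rewrite gt_eqF.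
have i0 : 0 < s^-1 by rewrite invr_gt0.
have si : s * s^-1 = 1 by rewrite mulfV // gt_eqF.
have [xs|xs] := leP (x * s) 4.
  have : x <= 4 * s^-1 by rewrite -ler_pdivrMr ?invr_gt0 // invrK.
  lra.
have i3 : s^-1 <= 1 / 3 by nra.
have xi : 4 * s^-1 < x by rewrite -ltr_pdivlMr ?invr_gt0 // invrK.
have x2 : x ^+ 2 * 29 - 16 = (x - 4 * s^-1) * (x * 29 + 4 * s).
  rewrite -s2; have -> : (x - 4 * s^-1) * (x * s ^+ 2 + 4 * s) = x ^+ 2 * s ^+ 2 +
    4 * x * s - 4 * x * s * (s * s^-1) - 16 * (s * s^-1) by ring.
  by rewrite si; ring.
(* The second factor is at least 8s >= 24, and 24/192 = 1/8 is exactly the slope of [g1]. *)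
have : 24 * (x - 4 * s^-1) <= (x - 4 * s^-1) * (x * 29 + 4 * s).
  rewrite mulrC ler_wpM2l //; first by rewrite subr_ge0 ltW.
  by have : x * 29 >= 4 * s by [nra]; nra.
lra.
Qed.

Lemma BT_of_schwarz c : rad_ge1 c -> c 0%N = 0 ->
  (forall z, cmod z < 1 -> cmod (pser c z) < 1) ->
  exists a, [/\ rad_ge1 a, in_BT a &
    forall z, cmod z < 1 -> derive1 (pser a) z = Bfun (pser c z)].
Proof.
move=> gc c0 c1.
have hB : papprox (fun z => Bfun (pser c z)).
  by apply: papprox_Bfun (papprox_pser gc) _ => z z1; rewrite ltW // c1.
have [b [gb hb]] := weierstrass hB.
have ga := rad_ge1_icoef gb; exists (icoef b).
have da z : cmod z < 1 -> derive1 (pser (icoef b)) z = Bfun (pser c z).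
  by move=> z1; rewrite derive1_pser // dcoefK hb.
split=> //; split; last first.
  exists c; split=> //; first exact: rad_ge1_analytic.
    by move=> z /inDE /c1 /inDE.
  by move=> z /inDE; exact: da.
split=> //; first by rewrite /icoef divr1 -(pser0 gb) hb ?cmod0 // pser0 // c0 Bfun0.
  exact: rad_ge1_analytic.
move=> z w /inDE z1 /inDE w1; apply: pser_inj => // u u1.
by rewrite dcoefK hb // Re_Bfun_gt0 // ltW // c1.
Qed.

(** * The two extremal Schwarz functions *)

Definition sqr_coef (k : nat) : C := (k == 2%N)%:R.

Lemma rad_ge1_of_le1 a : (forall k, cmod (a k) <= 1) -> rad_ge1 a.
Proof.
move=> h r r0 r1; exists 1 => k.
by rewrite mulr_ile1 ?cmod_ge0 ?exprn_ge0 ?exprn_ile1 // ltW.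
Qed.

Lemma rad_ge1_sqr_coef : rad_ge1 sqr_coef.
Proof. by apply: rad_ge1_of_le1 => k; rewrite cmod_nat; case: eqP; rewrite ?lexx ?ler01. Qed.

Lemma pser_sqr_coef z : pser sqr_coef z = z ^+ 2.
Proof.
apply: pser_uniq => e e0; exists 3 => n n3;
  rewrite horner_poly (bigD1 (Ordinal n3)) //= big1 => [|i].
  by rewrite /sqr_coef eqxx mul1r addr0 subrr cmod0 ltW.
by rewrite /sqr_coef -val_eqE /= => /negbTE ->; rewrite mul0r.
Qed.

Lemma pser_geo A q z : cmod q <= 1 -> cmod z < 1 ->
  pser (fun k => A * q ^+ k) z = A / (1 - q * z).
Proof.
move=> q1 z1; have qz : cmod (q * z) <= cmod z by rewrite cmodM ler_piMl // cmod_ge0.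
have d0 : 1 - q * z != 0.
  rewrite subr_eq0; apply/eqP => h; move: qz; rewrite -h cmod1.
  by rewrite leNgt z1.
apply: pser_uniq => e e0.
have [N hN] := geo_small (cmod_ge0 (A / (1 - q * z))) (cmod_ge0 z) z1 e0.
exists N => n Nn; rewrite horner_poly.
have -> : \sum_(i < n) A * q ^+ i * z ^+ i = A / (1 - q * z) - A / (1 - q * z) * (q * z) ^+ n.
  have -> : \sum_(i < n) A * q ^+ i * z ^+ i = A * \sum_(i < n) (q * z) ^+ i.
    by rewrite big_distrr /=; apply: eq_bigr => i _; rewrite exprMn mulrA.
  have := subrX1 (q * z) n; set S := \sum_(i < n) _ => E.
  have -> : (q * z) ^+ n = 1 + (q * z - 1) * S by rewrite -E; ring.
  by field.
rewrite addrAC subrr add0r cmodN cmodM cmodX (le_trans _ (hN n Nn)) // ler_wpM2l ?cmod_ge0 //.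
by rewrite lerXn2r ?nnegrE ?cmod_ge0.
Qed.

(* Taylor coefficients at 0 of the Blaschke product z (z + x) / (1 + x z). *)
Definition blaschke_coef (x : R) (k : nat) : C :=
  match k with 0 => 0 | 1 => x%:C | j.+2 => (1 - x ^+ 2)%:C * (- x%:C) ^+ j end.

Lemma rad_ge1_blaschke_coef (x : R) : 0 <= x -> x <= 1 -> rad_ge1 (blaschke_coef x).
Proof.
move=> x0 x1; apply: rad_ge1_of_le1 => -[|[|k]] /=; rewrite ?cmod0 ?ler01 //.
  by rewrite cmodr ger0_norm.
have x2 : 0 <= 1 - x ^+ 2 by rewrite subr_ge0 expr_le1.
rewrite cmodM cmodX cmodN !cmodr (ger0_norm x0) (ger0_norm x2).
by apply: mulr_ile1 => //; rewrite ?exprn_ge0 ?exprn_ile1 // gerBl sqr_ge0.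
Qed.

Lemma blaschke_den_neq0 (x : R) z : 0 <= x -> x <= 1 -> cmod z < 1 -> 1 + x%:C * z != 0.
Proof.
move=> x0 x1 z1; rewrite addrC addr_eq0; apply/eqP => /(congr1 (@cmod R)).
by rewrite cmodN cmod1 cmodM cmodr ger0_norm // => E; have := cmod_ge0 z; nra.
Qed.

Lemma pser_blaschke (x : R) z : 0 <= x -> x <= 1 -> cmod z < 1 ->
  pser (blaschke_coef x) z = z * (z + x%:C) / (1 + x%:C * z).
Proof.
move=> x0 x1 z1; have g := rad_ge1_blaschke_coef x0 x1.
have nx : cmod (- x%:C) <= 1 by rewrite cmodN cmodr ger0_norm.
rewrite (pser_shift g z1) (pser_shift (rad_ge1_shift g) z1) /= pser_geo //.
rewrite mulNr opprK rmorphB rmorphXn rmorph1 /=; field.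
exact: blaschke_den_neq0.
Qed.

(** |1 + xz|^2 - |z + x|^2 = (1 - x^2)(1 - |z|^2) >= 0, and the factor z makes the inequality
    strict. *)
Lemma blaschke_lt1 (x : R) z : 0 <= x -> x <= 1 -> cmod z < 1 ->
  cmod (z * (z + x%:C) / (1 + x%:C * z)) < 1.
Proof.
move=> x0 x1 z1; have z0 := cmod_ge0 z.
have h : cmod (z + x%:C) <= cmod (1 + x%:C * z).
  rewrite -(ler_pXn2r (n := 2)) ?nnegrE ?cmod_ge0 //.
  have : cmod z ^+ 2 <= 1 by rewrite expr_le1 // ltW.
  have : x ^+ 2 <= 1 by rewrite expr_le1.
  by rewrite !sqr_cmod; case: z {z0 z1} => u v /=; nra.
rewrite !cmodM cmodV; set D := cmod (1 + _) in h *.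
(* A zero denominator is harmless under the convention that its inverse is 0. *)
have [->|D0] := eqVneq D 0; first by rewrite invr0 mulr0.
have Dp : 0 < D by rewrite lt_neqAle eq_sym D0 cmod_ge0.
rewrite ltr_pdivrMr // mul1r; have := cmod_ge0 (z + x%:C); nra.
Qed.

(** As 8/sqrt 29 = 2x, over the common denominator 1 - z^2 the numerators of p - 1 and p + 1 are
    2z(z + x) and 2(1 + xz). *)
Lemma omega_low_blaschke z : cmod z < 1 ->
  let x := 4 / Num.sqrt (29 : R) in
  omega_low z = z * (z + x%:C) / (1 + x%:C * z).
Proof.
move=> z1 x.
have s5 : 5 <= Num.sqrt (29 : R).
  have s2 : Num.sqrt (29 : R) ^+ 2 = 29 by rewrite sqr_sqrtr.
  have := sqrtr_ge0 (29 : R); nra.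
have x0 : 0 <= x by rewrite /x divr_ge0 // sqrtr_ge0.
have x1 : x <= 1 by rewrite /x ler_pdivrMr ?mul1r; lra.
have h0 := blaschke_den_neq0 x0 x1 z1.
have h1 : 1 - z ^+ 2 != 0.
  rewrite subr_eq0; apply/eqP => h; have : cmod (z ^+ 2) = 1 by rewrite -h cmod1.
  by rewrite cmodX; have := cmod_ge0 z; nra.
rewrite /omega_low /p_low.
have -> : (8 / Num.sqrt (29 : R))%:C = 2 * x%:C.
  by rewrite -(rmorph_nat (@real_complex R) 2) -rmorphM /x; congr (_%:C); ring.
field; apply/and3P; split=> //.
set X := (X in 1 + 2 * X * z); have -> : 1 + 2 * X * z + z ^+ 2 + (1 - z ^+ 2) = 2 * (1 + X * z)
  by ring.
by rewrite mulf_neq0 // pnatr_eq0.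
Qed.

(** * The two bounds and their attainment *)

Lemma Gamma_diffE a : `|Gamma2 a| - `|Gamma1 a| = (cmod (Gamma2 a) - cmod (Gamma1 a))%:C.
Proof. by rewrite !normE rmorphB. Qed.

Lemma ratio_realE (k : R) : - 1 / k%:C = (- (1 / k))%:C.
Proof. by rewrite rmorphN rmorphM fmorphV rmorph1 mulNr. Qed.

Lemma inv12_realE : 1 / 12 = (1 / 12)%:C :> C.
Proof. by rewrite rmorphM fmorphV rmorph1 rmorph_nat. Qed.

Lemma BT_bounds a : in_BT a ->
  - 1 / (2 * Num.sqrt (29 : R))%:C <= `|Gamma2 a| - `|Gamma1 a|
  /\ `|Gamma2 a| - `|Gamma1 a| <= 1 / 12.
Proof.
move=> [[_ _ /analytic_rad_ge1 ga _] [c [c0 /analytic_rad_ge1 gc c1 da]]].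
have {}c1 z : cmod z < 1 -> cmod (pser c z) < 1 by move=> /inDE /c1 /inDE.
have {}da z : cmod z < 1 -> derive1 (pser a) z = Bfun (pser c z) by move=> /inDE; exact: da.
have [G1 G2] := Gamma_of_subord ga gc c0 c1 da.
have [_ y1] := schwarz_pick_coef gc c0 c1.
rewrite Gamma_diffE ratio_realE inv12_realE !lecR.
have n192 : cmod (13 / 192 * c 1%N ^+ 2) = 13 / 192 * cmod (c 1%N) ^+ 2.
  by rewrite !cmodM cmodV !cmod_nat expr2.
have n12 : cmod (c 2%N / 12) = cmod (c 2%N) / 12 by rewrite cmodM cmodV cmod_nat.
apply: (Gamma_diff_bounds (cmod_ge0 (c 1%N)) (cmod_ge0 _) y1).
- by rewrite G1 cmodN cmodM cmodV cmod_nat.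
- rewrite G2 lerBlDr -n192 -n12; have := cmodD (Gamma2 a) (c 2%N / 12).
  by rewrite G2 subrK.
- by rewrite G2 -n192 -n12 cmodB.
Qed.

Lemma BT_upper_extremal : exists a : nat -> C, in_BT a
  /\ (forall z, inD z -> derive1 (pser a) z = Bfun (z ^+ 2))
  /\ `|Gamma2 a| - `|Gamma1 a| = 1 / 12.
Proof.
have c1 z : cmod z < 1 -> cmod (pser sqr_coef z) < 1.
  by move=> z1; rewrite pser_sqr_coef cmodX expr_lt1 // cmod_ge0.
have [a [ga ha da]] := BT_of_schwarz rad_ge1_sqr_coef erefl c1.
have [G1 G2] := Gamma_of_subord ga rad_ge1_sqr_coef erefl c1 da.
exists a; split=> //; split.
  by move=> z /inDE z1; rewrite da // pser_sqr_coef.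
(* Here c_1 = 0 and c_2 = 1, so the first coefficient vanishes and the second is -1/12. *)
rewrite Gamma_diffE inv12_realE G1 G2 /sqr_coef /= mul0r oppr0 cmod0 subr0.
by rewrite expr0n mulr0 sub0r cmodN cmodM cmod1 cmodV cmod_nat.
Qed.

Lemma BT_lower_extremal : exists a : nat -> C, in_BT a
  /\ (forall z, inD z -> derive1 (pser a) z = Bfun (omega_low z))
  /\ `|Gamma2 a| - `|Gamma1 a| = - 1 / (2 * Num.sqrt (29 : R))%:C.
Proof.
pose x := 4 / Num.sqrt (29 : R).
have s2 : Num.sqrt (29 : R) ^+ 2 = 29 by rewrite sqr_sqrtr.
have s0 : 0 < Num.sqrt (29 : R) by rewrite sqrtr_gt0.
have x0 : 0 <= x by rewrite /x divr_ge0 // ltW.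
have x1 : x <= 1 by rewrite /x ler_pdivrMr ?mul1r; nra.
have x2 : x ^+ 2 = 16 / 29 by rewrite /x exprMn exprVn s2; field.
have gc := rad_ge1_blaschke_coef x0 x1.
have c1 z : cmod z < 1 -> cmod (pser (blaschke_coef x) z) < 1.
  by move=> z1; rewrite pser_blaschke // blaschke_lt1.
have [a [ga ha da]] := BT_of_schwarz gc erefl c1.
have [G1 G2] := Gamma_of_subord ga gc erefl c1 da.
exists a; split=> //; split.
  by move=> z /inDE z1; rewrite da // pser_blaschke // omega_low_blaschke.
rewrite Gamma_diffE ratio_realE.
have -> : Gamma2 a = (13 / 192 * x ^+ 2 - (1 - x ^+ 2) / 12)%:C.
  rewrite G2 /= expr0 mulr1 !(rmorphB, rmorphM, fmorphV, rmorphXn, rmorph_nat, rmorph1) /=; ring.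
rewrite G1 /= cmodN cmodM cmodV cmod_nat !cmodr (ger0_norm x0) x2; congr (_%:C).
(* Since 29 x^2 = 16, the second logarithmic coefficient vanishes and only -x/8 remains. *)
rewrite (_ : 13 / 192 * (16 / 29) - (1 - 16 / 29) / 12 = 0); last by field.
by rewrite normr0 sub0r /x; field; rewrite gt_eqF.
Qed.
End S9.

Unset Implicit Arguments. Set Strict Implicit. Set Printing Implicit Defensive.
Theorem theorem7p2 (R : realType) :
  (forall a : nat -> R[i], in_BT a ->
     - 1 / (2 * Num.sqrt (29 : R))%:C <= `|Gamma2 a| - `|Gamma1 a|
     /\ `|Gamma2 a| - `|Gamma1 a| <= 1 / 12)
  /\ (exists a : nat -> R[i], in_BT a
        /\ (forall z, inD z -> derive1 (pser a) z = Bfun (z ^+ 2))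
        /\ `|Gamma2 a| - `|Gamma1 a| = 1 / 12)
  /\ (exists a : nat -> R[i], in_BT a
        /\ (forall z, inD z -> derive1 (pser a) z = Bfun (omega_low z))
        /\ `|Gamma2 a| - `|Gamma1 a| = - 1 / (2 * Num.sqrt (29 : R))%:C).
Proof.
split; first exact: BT_bounds.
by split; [exact: BT_upper_extremal|exact: BT_lower_extremal].
Qed.
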